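(* Suppose $\sup R < \infty$. Let $M$ be locally finite in $\mathsf{D}^-(R)$. Let $g$ be an integer with $g \geq \sup R$. If the Bass numbers of $M$ have a gap of length $g$ in the sense that there is an integer $j$ such that $$\mu^{\ell}(M) \begin{cases} \neq 0 & \text{for } \ell = j,\\ = 0 & \text{for } j+1 \leq \ell \leq j+g,\\ \neq 0 & \text{for } \ell = j+g+1,\end{cases}$$ then $$\operatorname{amp} M \geq g+1.$$
   Context: $k$ is a field and $R$ is a cochain Differential Graded (DG) algebra over $k$ (cohomologically graded) of the form $\cdots \to 0 \to k \to 0 \to R^2 \to R^3 \to \cdots$, i.e. $R^j = 0$ for $j<0$, $R^0 = k$, $R^1 = 0$, with $\dim_k \mathrm{H}^j(R) < \infty$ for each $j$. $\mathsf{D}(R)$ is the derived category of DG left-$R$-modules, and $\mathsf{D}^-(R)$ is its full subcategory of those $M$ with $\mathrm{H}^j(M) = 0$ for $j \gg 0$. $k$ is viewed as a DG bi-$R$-module concentrated in degree $0$. A DG $R$-module $N$ is locally finite if $\dim_k \mathrm{H}^j(N) < \infty$ for each $j$. For a DG module $N$: $\inf N = \inf\{ j \mid \mathrm{H}^j(N) \neq 0\}$, $\sup N = \sup\{ j \mid \mathrm{H}^j(N)\neq 0\}$, $\operatorname{amp} N = \sup N - \inf N$, with the conventions $\inf \varnothing = \infty$, $\sup\varnothing = -\infty$. The Bass numbers of a DG left-$R$-module $M$ are $\mu^j(M) = \dim_k \mathrm{H}^j(\mathrm{RHom}_R(k,M))$, where $\mathrm{RHom}_R$ is the right derived Hom functor.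 *)

(* Defs.v *)
From HB Require Import structures.
From mathcomp Require Import all_boot all_order all_algebra.
From mathcomp Require Import boolp classical_sets constructive_ereal.

Set Implicit Arguments.
Unset Strict Implicit.
Unset Printing Implicit Defensive.

Import Order.TTheory GRing.Theory Num.Theory.
Local Open Scope ring_scope.

#[local] Obligation Tactic := idtac.

(** Gradings are cohomological and indexed by [int].  Every operation that
    changes the degree takes the target degree together with an equation as
    arguments (e.g. a product of degrees [i] and [j] lands in any degree [l] with
    [i + j = l]), so that no transport along degree equations is needed.  This
    is harmless since equality proofs in [int] are unique. *)

(** * Cochain complexes of vector spaces and their cohomology *)

Record complex (k : fieldType) := Complex {
  cx_obj :> int -> lmodType k;
  cx_d : forall i j : int, i + 1 = j -> {linear cx_obj i -> cx_obj j};
  cx_dd : forall (i j l : int) (e : i + 1 = j) (e' : j + 1 = l) (x : cx_obj i),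
    cx_d e' (cx_d e x) = 0 }.

Section Cohomology.
Context (k : fieldType) (C : complex k).

Definition cocycle (i : int) (x : C i) : Prop :=
  forall (j : int) (e : i + 1 = j), cx_d C e x = 0.

Definition coboundary (j : int) (x : C j) : Prop :=
  exists (i : int) (e : i + 1 = j) (y : C i), x = cx_d C e y.

(** [H^j(C) = 0] *)
Definition coh_zero (j : int) : Prop := forall x : C j, cocycle x -> coboundary x.

Definition acyclic : Prop := forall j, coh_zero j.

(** The classes of the cocycles [e 0, ..., e (n-1)] form a basis of [H^j(C)]. *)
Definition coh_basis (j : int) (n : nat) (e : 'I_n -> C j) : Prop :=
  (forall a, cocycle (e a)) /\
  (forall x, cocycle x ->
     exists! c : 'rV[k]_n, coboundary (x - \sum_(a < n) c 0 a *: e a)).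

(** [dim_k H^j(C)], with [None] standing for an infinite dimension *)
Definition coh_dim (j : int) : option nat :=
  xget None [set Some n | n in [set n | exists e : 'I_n -> C j, coh_basis e]]%classic.

Definition locally_finite : Prop := forall j, coh_dim j <> None.

(** [sup], [inf] and [amp] of the cohomology, as extended integers; note that
    [-oo - +oo = -oo] in [\bar int], so the amplitude of an acyclic complex
    is [-oo]. *)
Definition coh_sup : \bar int :=
  supremum (-oo)%E [set j%:E | j in [set j : int | ~ coh_zero j]]%classic.

Definition coh_inf : \bar int :=
  infimum (+oo)%E [set j%:E | j in [set j : int | ~ coh_zero j]]%classic.

Definition amp : \bar int := (coh_sup - coh_inf)%E.

End Cohomology.

(** * DG algebras and DG left modules *)

Record dgAlgebra (k : fieldType) := DGAlgebra {
  dga_cx :> complex k;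
  dga_mul : forall i j l : int, i + j = l -> dga_cx i -> dga_cx j -> dga_cx l;
  dga_one : dga_cx 0;
  dga_mul_linearl : forall (i j l : int) (e : i + j = l) (c : k) a a' b,
    dga_mul e (c *: a + a') b = c *: dga_mul e a b + dga_mul e a' b;
  dga_mul_linearr : forall (i j l : int) (e : i + j = l) (c : k) a b b',
    dga_mul e a (c *: b + b') = c *: dga_mul e a b + dga_mul e a b';
  dga_mulA : forall (i j l m n p : int) (eij : i + j = m) (em : m + l = p)
      (ejl : j + l = n) (en : i + n = p) a b c,
    dga_mul em (dga_mul eij a b) c = dga_mul en a (dga_mul ejl b c);
  dga_mul1l : forall (i : int) (e : 0 + i = i) a, dga_mul e dga_one a = a;
  dga_mul1r : forall (i : int) (e : i + 0 = i) a, dga_mul e a dga_one = a;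
  dga_leibniz : forall (i j m i' j' m' : int) (e : i + j = m) (ei : i + 1 = i')
      (ej : j + 1 = j') (em : m + 1 = m') (e1 : i' + j = m') (e2 : i + j' = m')
      a b,
    cx_d dga_cx em (dga_mul e a b) =
    dga_mul e1 (cx_d dga_cx ei a) b
    + (-1) ^ i *: dga_mul e2 a (cx_d dga_cx ej b) }.

(** DG algebras [... -> 0 -> k -> 0 -> R^2 -> R^3 -> ...] with locally finite
    cohomology *)
Record cochainDGA (k : fieldType) := CochainDGA {
  cdga_dga :> dgAlgebra k;
  cdga_neg : forall (i : int) (a : cdga_dga i), i < 0 -> a = 0;
  cdga_deg0 : bijective (fun c : k => c *: dga_one cdga_dga);
  cdga_deg1 : forall a : cdga_dga 1, a = 0;
  cdga_lf : locally_finite cdga_dga }.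

Record dgModule (k : fieldType) (R : dgAlgebra k) := DGModule {
  dgm_cx :> complex k;
  dgm_act : forall i j l : int, i + j = l -> R i -> dgm_cx j -> dgm_cx l;
  dgm_act_linearl : forall (i j l : int) (e : i + j = l) (c : k) a a' x,
    dgm_act e (c *: a + a') x = c *: dgm_act e a x + dgm_act e a' x;
  dgm_act_linearr : forall (i j l : int) (e : i + j = l) (c : k) a x x',
    dgm_act e a (c *: x + x') = c *: dgm_act e a x + dgm_act e a x';
  dgm_actA : forall (i j l m n p : int) (eij : i + j = m) (em : m + l = p)
      (ejl : j + l = n) (en : i + n = p) a b x,
    dgm_act em (dga_mul eij a b) x = dgm_act en a (dgm_act ejl b x);
  dgm_act1 : forall (i : int) (e : 0 + i = i) x, dgm_act e (dga_one R) x = x;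
  dgm_leibniz : forall (i j m i' j' m' : int) (e : i + j = m) (ei : i + 1 = i')
      (ej : j + 1 = j') (em : m + 1 = m') (e1 : i' + j = m') (e2 : i + j' = m')
      a x,
    cx_d dgm_cx em (dgm_act e a x) =
    dgm_act e1 (cx_d R ei a) x
    + (-1) ^ i *: dgm_act e2 a (cx_d dgm_cx ej x) }.

(** The objects of the derived category lying in [D^-(R)] *)
Definition in_Dminus (k : fieldType) (R : dgAlgebra k) (M : dgModule R) : Prop :=
  exists n : int, forall j : int, n < j -> coh_zero M j.

(** * The complex [Hom_R(P, M)] *)

Section Hom.
Context (k : fieldType) (R : dgAlgebra k) (P M : dgModule R).

(** Homogeneous [R]-linear maps of degree [n] *)
Record hom (n : int) := Hom {
  hom_fun :> forall i j : int, i + n = j -> P i -> M j;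
  hom_linear : forall (i j : int) (e : i + n = j) (c : k) x y,
    hom_fun e (c *: x + y) = c *: hom_fun e x + hom_fun e y;
  hom_act : forall (a i b j c : int) (eb : a + i = b) (ec : b + n = c)
      (ej : i + n = j) (ec' : a + j = c) (r : R a) (x : P i),
    hom_fun ec (dgm_act eb r x) = (-1) ^ (n * a) *: dgm_act ec' r (hom_fun ej x) }.

Lemma homP (n : int) (f g : hom n) :
  (forall (i j : int) (e : i + n = j) x, f i j e x = g i j e x) -> f = g.
Proof.
case: f g => [f fl fa] [g gl ga] /= fg.
have E : f = g.
  apply: functional_extensionality_dep => i.
  apply: functional_extensionality_dep => j.
  apply: functional_extensionality_dep => e.
  by apply: functional_extensionality_dep => x; exact: fg.
by subst g; congr Hom; exact: Prop_irrelevance.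
Qed.

Lemma dgm_act0 (i j l : int) (e : i + j = l) (a : R i) : dgm_act e a (0 : M j) = 0.
Proof.
have := dgm_act_linearr e (-1) a (0 : M j) 0.
by rewrite scaler0 addr0 scaleN1r addNr.
Qed.

Lemma dgm_actD (i j l : int) (e : i + j = l) (a : R i) (x y : M j) :
  dgm_act e a (x + y) = dgm_act e a x + dgm_act e a y.
Proof. by have := dgm_act_linearr e 1 a x y; rewrite !scale1r. Qed.

Lemma dgm_actZ (i j l : int) (e : i + j = l) (a : R i) c (x : M j) :
  dgm_act e a (c *: x) = c *: dgm_act e a x.
Proof. by have := dgm_act_linearr e c a x 0; rewrite !addr0 dgm_act0 addr0. Qed.

Lemma homZ (n : int) (f : hom n) (i j : int) (e : i + n = j) c x : f i j e (c *: x) = c *: f i j e x.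
Proof.
have f0 : f i j e 0 = 0.
  by have := hom_linear f e (-1) 0 0; rewrite scaler0 addr0 scaleN1r addNr.
by have := hom_linear f e c x 0; rewrite !addr0 f0 addr0.
Qed.

Lemma homD (n : int) (f : hom n) (i j : int) (e : i + n = j) x y :
  f i j e (x + y) = f i j e x + f i j e y.
Proof. by have := hom_linear f e 1 x y; rewrite !scale1r. Qed.

Program Definition hom_zero (n : int) : hom n := @Hom n (fun i j e x => 0) _ _.
Next Obligation. by move=> * /=; rewrite scaler0 addr0. Qed.
Next Obligation. by move=> * /=; rewrite dgm_act0 scaler0. Qed.

Program Definition hom_add (n : int) (f g : hom n) : hom n :=
  @Hom n (fun i j e x => f i j e x + g i j e x) _ _.
Next Obligation. by move=> * /=; rewrite !hom_linear scalerDr addrACA. Qed.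
Next Obligation.
move=> n f g a i b j c eb ec ej ec' r x. rewrite /=.
by rewrite !(hom_act _ eb ec ej ec') dgm_actD scalerDr.
Qed.

Program Definition hom_scale (n : int) (s : k) (f : hom n) : hom n :=
  @Hom n (fun i j e x => s *: f i j e x) _ _.
Next Obligation.
by move=> n s f i j e c x y /=; rewrite hom_linear scalerDr !scalerA mulrC.
Qed.
Next Obligation.
move=> n s f a i b j c eb ec ej ec' r x. rewrite /=.
by rewrite !(hom_act _ eb ec ej ec') dgm_actZ !scalerA mulrC.
Qed.

HB.instance Definition _ (n : int) := gen_eqMixin (hom n).
HB.instance Definition _ (n : int) := gen_choiceMixin (hom n).

Section Lmod.
Context (n : int).

Lemma hom_addA : associative (@hom_add n).
Proof. by move=> f g h; apply: homP => i j e x /=; rewrite addrA. Qed.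

Lemma hom_addC : commutative (@hom_add n).
Proof. by move=> f g; apply: homP => i j e x /=; rewrite addrC. Qed.

Lemma hom_add0 : left_id (hom_zero n) (@hom_add n).
Proof. by move=> f; apply: homP => i j e x /=; rewrite add0r. Qed.

Lemma hom_addN : left_inverse (hom_zero n) (@hom_scale n (-1)) (@hom_add n).
Proof. by move=> f; apply: homP => i j e x /=; rewrite scaleN1r addNr. Qed.

HB.instance Definition _ :=
  GRing.isZmodule.Build (hom n) hom_addA hom_addC hom_add0 hom_addN.

Lemma hom_scaleA (a b : k) (f : hom n) :
  hom_scale a (hom_scale b f) = hom_scale (a * b) f.
Proof. by apply: homP => i j e x /=; rewrite scalerA. Qed.

Lemma hom_scale1 : left_id 1 (@hom_scale n).
Proof. by move=> f; apply: homP => i j e x /=; rewrite scale1r. Qed.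

Lemma hom_scaleDr : right_distributive (@hom_scale n) +%R.
Proof. by move=> a f g; apply: homP => i j e x /=; rewrite scalerDr. Qed.

Lemma hom_scaleDl (f : hom n) : {morph (@hom_scale n)^~ f : a b / a + b}.
Proof. by move=> a b; apply: homP => i j e x /=; rewrite scalerDl. Qed.

HB.instance Definition _ :=
  GRing.Zmodule_isLmodule.Build k (hom n)
    hom_scaleA hom_scale1 hom_scaleDr hom_scaleDl.

End Lmod.

(** The differential [f |-> d o f - (-1)^n f o d] *)

Lemma hom_deg_pred (i n m j : int) : n + 1 = m -> i + m = j -> i + n = j - 1.
Proof. by move=> <- <-; rewrite addrA addrK. Qed.

Lemma hom_deg_succ (i n m j : int) : n + 1 = m -> i + m = j -> (i + 1) + n = j.
Proof. by move=> <- <-; rewrite -addrA (addrC 1). Qed.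

Definition hom_diff_fun (n m : int) (e : n + 1 = m) (f : hom n) (i j : int) (ej : i + m = j)
    (x : P i) : M j :=
  cx_d M (subrK 1 j) (f i (j - 1) (hom_deg_pred e ej) x)
  - (-1) ^ n *: f (i + 1) j (hom_deg_succ e ej) (cx_d P erefl x).

(* Any choice of intermediate degrees gives the same value. *)
Lemma hom_diff_funE (n m : int) (e : n + 1 = m) (f : hom n) (i j : int) (ej : i + m = j) x
    (i' j' : int) (ei : i + 1 = i') (ej' : j' + 1 = j) (e1 : i + n = j') (e2 : i' + n = j) :
  hom_diff_fun e f ej x =
  cx_d M ej' (f i j' e1 x) - (-1) ^ n *: f i' j e2 (cx_d P ei x).
Proof.
rewrite /hom_diff_fun.
have Ej' : j' = j - 1 by rewrite -ej' addrK.
subst i'; move: ej' e1; rewrite Ej' => ej' e1.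
by rewrite (eq_irrelevance (subrK 1 j) ej') (eq_irrelevance (hom_deg_pred e ej) e1)
  (eq_irrelevance (hom_deg_succ e ej) e2).
Qed.

Program Definition hom_diff (n m : int) (e : n + 1 = m) (f : hom n) : hom m :=
  @Hom m (fun i j ej x => hom_diff_fun e f ej x) _ _.
Next Obligation.
move=> n m e f i j ej c x y; rewrite /hom_diff_fun !linearP /= !hom_linear linearP /=.
by rewrite scalerDr !scalerA opprD addrACA mulrC -scalerA -scalerBr.
Qed.
Next Obligation.
move=> n m e f a i b j c eb ec ej ec' r x.
have e1 : i + n = j - 1 by exact: hom_deg_pred e ej.
have e2 : a + (j - 1) = c - 1 by rewrite addrA ec'.
have e3 : b + n = c - 1 by exact: hom_deg_pred e ec.
have e4 : (b + 1) + n = c by exact: hom_deg_succ e ec.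
have e5 : a + (i + 1) = b + 1 by rewrite addrA eb.
have e6 : (a + 1) + i = b + 1 by rewrite -eb addrAC.
have e7 : (i + 1) + n = j by exact: hom_deg_succ e ej.
have e8 : (a + 1) + (j - 1) = c by rewrite addrACA subrr addr0.
rewrite (hom_diff_funE e f ec _ (erefl (b + 1)) (subrK 1 c) e3 e4).
rewrite (hom_diff_funE e f ej _ (erefl (i + 1)) (subrK 1 j) e1 e7).
rewrite (hom_act f eb e3 e1 e2) linearZ /=.
rewrite (dgm_leibniz e2 (erefl (a + 1)) (subrK 1 j) (subrK 1 c) e8 ec').
rewrite (dgm_leibniz eb (erefl (a + 1)) (erefl (i + 1)) (erefl (b + 1)) e6 e5).
rewrite homD homZ (hom_act f e6 e4 e1 e8) (hom_act f e5 e4 e7 ec').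
have N1 : (-1 : k) != 0 by rewrite oppr_eq0 oner_eq0.
have sq (z : int) : (-1 : k) ^ z * (-1) ^ z = 1.
  by rewrite -exprzMl ?unitrN1 // mulrNN mulr1 exp1rz.
set u := dgm_act e8 _ _; set v := dgm_act ec' r (cx_d M _ _).
have -> : dgm_act ec' r (cx_d M (subrK 1 j) (f i (j - 1) e1 x)
    - (-1) ^ n *: f (i + 1) j e7 (cx_d P erefl x)) =
  v - (-1) ^ n *: dgm_act ec' r (f (i + 1) j e7 (cx_d P erefl x)).
  by rewrite dgm_actD -!scaleNr dgm_actZ.
set w := dgm_act ec' r (f _ _ _ _).
rewrite !scalerDr !scalerN !scalerA -e !mulrDr !mulrDl !mulr1 !mul1r.
rewrite !expfzDr //.
have -> : (-1 : k) ^ n * ((-1) ^ (n * a) * (-1) ^ n) = (-1) ^ (n * a).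
  by rewrite mulrCA sq mulr1.
rewrite opprD addrACA subrr add0r; congr (_ *: _ - _ *: _).
by rewrite mulrAC -mulrA mulrC -mulrA mulrC.
Qed.

Lemma hom_diff_linear (n m : int) (e : n + 1 = m) : linear (hom_diff e).
Proof.
move=> c f g; apply: homP => i j ej x; rewrite /= /hom_diff_fun /=.
rewrite linearD linearZ /= scalerDr scalerBr opprD addrACA.
by rewrite !scalerA mulrC.
Qed.

HB.instance Definition _ (n m : int) (e : n + 1 = m) :=
  GRing.isLinear.Build k (hom n) (hom m) *:%R (hom_diff e) (hom_diff_linear e).

Lemma hom_diffK (n m p : int) (e : n + 1 = m) (e' : m + 1 = p) (f : hom n) :
  hom_diff e' (hom_diff e f) = 0.
Proof.
apply: homP => i j ej x /=.
have e1 : i + m = j - 1 by exact: hom_deg_pred e' ej.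
have e2 : i + n = j - 1 - 1 by exact: hom_deg_pred e e1.
have e3 : (i + 1) + m = j by exact: hom_deg_succ e' ej.
have e4 : (i + 1) + n = j - 1 by exact: hom_deg_succ e e1.
have e5 : (i + 1 + 1) + n = j by exact: hom_deg_succ e e3.
rewrite (hom_diff_funE e' _ ej x (erefl (i + 1)) (subrK 1 j) e1 e3) /=.
rewrite (hom_diff_funE e f e1 x (erefl (i + 1)) (subrK 1 (j - 1)) e2 e4).
rewrite (hom_diff_funE e f e3 _ (erefl (i + 1 + 1)) (subrK 1 j) e4 e5).
rewrite linearB linearZ /= !cx_dd.
have -> : f (i + 1 + 1) j e5 0 = 0 by rewrite -(scale0r 0) homZ scale0r.
rewrite scaler0 subr0 sub0r -e expfzDr ?oppr_eq0 ?oner_eq0 //.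
by rewrite expr1z mulrN1 scaleNr opprK addNr.
Qed.

Definition hom_cx : complex k :=
  @Complex k (fun n => hom n) (fun n m e => hom_diff e) hom_diffK.

End Hom.

(** * K-projective resolutions *)

Section Resolutions.
Context (k : fieldType) (R : dgAlgebra k).

Definition K_projective (P : dgModule R) : Prop :=
  forall N : dgModule R, acyclic N -> acyclic (hom_cx P N).

(** Morphisms of DG modules are the cocycles of degree [0] in the Hom complex;
    such a morphism is a quasi-isomorphism when it induces bijections in
    cohomology. *)
Definition quasi_iso (P N : dgModule R) (f : hom P N 0) : Prop :=
  [/\ cocycle (C := hom_cx P N) f,
      (forall (i : int) (x : P i), cocycle x -> coboundary (f i i (addr0 i) x) ->
         coboundary x)
    & (forall (i : int) (y : N i), cocycle y ->
         exists2 x : P i, cocycle x & coboundary (y - f i i (addr0 i) x))].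

Record Kproj_resolution (N : dgModule R) := KprojResolution {
  kpr_obj :> dgModule R;
  kpr_map : hom kpr_obj N 0;
  kpr_quasi_iso : quasi_iso kpr_map;
  kpr_K_projective : K_projective kpr_obj }.

(** [RHom_R(N, M)], computed from a K-projective resolution of [N] *)
Definition RHom (N : dgModule R) (P : Kproj_resolution N) (M : dgModule R) :
  complex k := hom_cx P M.

End Resolutions.

(** * The DG module [k] and the Bass numbers *)

Section Residue.
Context (k : fieldType) (R : cochainDGA k).

(** The augmentation [R -> k] *)
Definition aug (i : int) : R i -> k :=
  match i return R i -> k with
  | Posz 0 => fun a => xget 0 [set c : k | c *: dga_one R = a]%classic
  | _ => fun=> 0
  end.

Lemma aug_deg0 (a : R 0) : aug a *: dga_one R = a.
Proof.
have [g _ gK] := cdga_deg0 R.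
exact: (@xgetI k 0 [set c : k | c *: dga_one R = a]%classic (g a) (gK a)).
Qed.

Lemma augZ1 (c : k) : aug (c *: dga_one R) = c.
Proof. by apply: (bij_inj (cdga_deg0 R)); rewrite aug_deg0. Qed.

Lemma aug_neq0 (i : int) (a : R i) : i != 0 -> aug a = 0.
Proof. by case: i a => [[|i]|i]. Qed.

Lemma aug_linear (i : int) (c : k) (a b : R i) :
  aug (c *: a + b) = c * aug a + aug b.
Proof.
have [i0|i0] := eqVneq i 0; last by rewrite !aug_neq0 // mulr0 addr0.
by subst i; rewrite -{1}(aug_deg0 a) -{1}(aug_deg0 b) scalerA -scalerDl augZ1.
Qed.

Lemma aug0 (i : int) : aug (0 : R i) = 0.
Proof. by have := aug_linear (-1) (0 : R i) 0; rewrite scaler0 addr0 mulN1r addNr. Qed.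

Lemma aug1 : aug (dga_one R) = 1.
Proof. by rewrite -[dga_one R]scale1r augZ1. Qed.

Lemma dga_mul0l (i j l : int) (e : i + j = l) (b : R j) : dga_mul e (0 : R i) b = 0.
Proof.
have := dga_mul_linearl e (-1) (0 : R i) 0 b.
by rewrite scaler0 addr0 scaleN1r addNr.
Qed.

Lemma dga_mul0r (i j l : int) (e : i + j = l) (a : R i) : dga_mul e a (0 : R j) = 0.
Proof.
have := dga_mul_linearr e (-1) a (0 : R j) 0.
by rewrite scaler0 addr0 scaleN1r addNr.
Qed.

Lemma augM (i j l : int) (e : i + j = l) (a : R i) (b : R j) :
  aug (dga_mul e a b) = aug a * aug b.
Proof.
have [i0|i0|i0] := ltrgtP i 0.
- by rewrite (cdga_neg a i0) dga_mul0l !aug0 mul0r.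
- have [j0|j0] := ltP j 0; first by rewrite (cdga_neg b j0) dga_mul0r !aug0 mulr0.
  rewrite (@aug_neq0 i) ?gt_eqF // mul0r aug_neq0 // -e gt_eqF //.
  exact: ltr_wpDr.
- subst i; rewrite -{1}(aug_deg0 a).
  have E : l = j by rewrite -e add0r.
  move: e; rewrite E => e.
  have := dga_mul_linearl e (aug a) (dga_one R) 0 b.
  rewrite addr0 => ->; rewrite dga_mul0l dga_mul1l aug_linear aug0 addr0 //.
Qed.

Lemma aug_d (i j : int) (e : i + 1 = j) (a : R i) : aug (cx_d R e a) = 0.
Proof.
have [j0|j0] := eqVneq j 0; last exact: aug_neq0.
have i0 : i < 0 by rewrite -(ltrD2r 1) e j0 add0r.
by rewrite (cdga_neg a i0) linear0 aug0.
Qed.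

(** The underlying graded space of [k]: row vectors of length [1] in degree [0],
    and of length [0] in all other degrees *)
Definition residue_obj (i : int) : lmodType k := 'rV[k]_(i == 0).

Definition residue_d (i j : int) (e : i + 1 = j) :
  {linear residue_obj i -> residue_obj j} := \0.

Definition residue_cx : complex k :=
  @Complex k residue_obj residue_d (fun i j l e e' x => erefl).

(** The sum below is the coordinate of [x] when [j = 0], and [0] otherwise. *)
Definition residue_act (i j l : int) (e : i + j = l) (a : R i)
    (x : residue_cx j) : residue_cx l :=
  const_mx (aug a * \sum_s (x : 'rV[k]_(j == 0)) 0 s).

Lemma residue_sum_const (i : int) (c : k) :
  i = 0 -> \sum_s (const_mx c : 'rV[k]_(i == 0)) 0 s = c.
Proof. by move=> ->; rewrite big_ord1 mxE. Qed.

Lemma residue_eq0 (i : int) (x : residue_obj i) : i != 0 -> x = 0.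
Proof.
by move=> /negbTE i0; apply/rowP => -[s sP]; exfalso; rewrite i0 in sP.
Qed.

(* A disjunction, because a boolean case analysis on [i == 0] would abstract
   the size of the vectors. *)
Lemma eq0_or (i : int) : i = 0 \/ i != 0.
Proof. by have [|] := eqVneq i 0; [left | right]. Qed.

Program Definition residue : dgModule R := @DGModule k R residue_cx residue_act _ _ _ _ _.
Next Obligation.
move=> i j l e c a a' x; apply/rowP => s; rewrite !mxE aug_linear.
by rewrite mulrDl mulrA.
Qed.
Next Obligation.
move=> i j l e c a x x'; apply/rowP => s; rewrite !mxE.
under eq_bigr do rewrite !mxE.
by rewrite big_split /= -mulr_sumr mulrDr mulrCA.
Qed.
Next Obligation.
move=> i j l m n p eij em ejl en a b x; apply/rowP => s; rewrite !mxE augM.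
have [n0|n0] := eq0_or n; first by rewrite residue_sum_const // mulrA.
have [j0|j0] := eq0_or j.
  have l0 : l != 0 by rewrite -ejl j0 add0r in n0.
  by rewrite (residue_eq0 x l0) !big1 ?mulr0 // => t _; rewrite !mxE ?big1 ?mulr0 // => ? _; rewrite mxE.
by rewrite (aug_neq0 b j0) mulr0 !mul0r big1 ?mulr0 // => t _; rewrite mxE (aug_neq0 b j0) mul0r.
Qed.
Next Obligation.
move=> i e x; have [i0|i0] := eq0_or i; last by rewrite (residue_eq0 x i0); exact: residue_eq0.
subst i; apply/rowP => s; rewrite !mxE aug1 mul1r big_ord1.
by congr (x _ _); apply/val_inj; case: s => -[].
Qed.
Next Obligation.
move=> i j m i' j' m' e ei ej em e1 e2 a x; apply/rowP => s; rewrite !mxE aug_d mul0r add0r.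
by rewrite big1 ?mulr0 // => t _; rewrite mxE.
Qed.

(** The Bass number [mu^l(M)], relative to a model of [RHom_R(k, -)] *)
Definition bass (P : Kproj_resolution residue) (M : dgModule R) (l : int) :
  option nat := coh_dim (RHom P M) l.

End Residue.

(* Main.v *)
From HB Require Import structures.
From mathcomp Require Import all_boot all_order all_algebra.
From mathcomp Require Import boolp classical_sets constructive_ereal.
From mathcomp Require Import zify.
Require Import Defs.

Set Implicit Arguments.
Unset Strict Implicit.
Unset Printing Implicit Defensive.

Import Order.TTheory GRing.Theory Num.Theory.
Local Open Scope ring_scope.

#[local] Obligation Tactic := idtac.

(** The gap in the Bass numbers forces two cohomology groups of [M] to be
    nonzero: [H^j(M)], and [H^l(M)] for some [l >= j + g + 1].  This gives
    [amp M >= g + 1] at once.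

    The second one is a degree count.  A K-projective resolution [P] of [k] has
    no cohomology in negative degrees, hence is equivalent to a DG module living
    in nonnegative degrees; if the cohomology of [M] vanishes in all degrees
    [>= c], then a map [P -> M] of degree [>= c] factors up to homotopy through
    an acyclic submodule of [M], so [mu^c(M) = 0] ([coh_zero_hom_above]).

    For the first one, suppose that [H^j(M) = 0] and that [mu^l(M) = 0] for
    [j < l <= j + g] ([gap_propagates]).  The DG module [R] has cohomology [k] in
    degree [0] and otherwise finite-dimensional cohomology in degrees [2, ..., g]
    only.  Let [F] be the fibre of the canonical map [R -> P].  It has
    cohomology in degrees [2, ..., g], so it is built in finitely many steps from
    copies of [P] shifted to these degrees.  Each of these copies contributes to
    [H^(j-1)(Hom(F, M))] only a Bass number [mu^l(M)] with [j < l < j + g], and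
    these vanish; therefore [H^(j-1)(Hom(F, M)) = 0]
    ([coh_zero_hom_of_bounded]).  The exact sequence
    [H^(j-1)(Hom(F, M)) -> H^j(Hom(P, M)) -> H^j(Hom(R, M)) = H^j(M) = 0] now
    yields [mu^j(M) = 0].

    One step of the construction removes one cohomology class from the lowest
    nonzero degree [a] of a K-projective DG module [T].  Truncating [T] below
    [a], which is possible because [R] lives in nonnegative degrees with
    [R^0 = k], one finds a map from [T] to [k] of degree [-a] that detects the
    class.  It lifts to a map [T -> P], whose fibre is the next module
    ([exists_class_killing_hom]).

    All long exact sequences are replaced by explicit manipulations with one
    construction, the fibre of a chain map of arbitrary degree. *)

(** * Complements in vector spaces of arbitrary dimension *)

Section Complements.
Context (k : fieldType) (V : lmodType k).

Definition subspace (U : set V) : Prop :=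
  U 0 /\ forall (c : k) x y, U x -> U y -> U (c *: x + y).

Lemma subspaceB (U : set V) x y : subspace U -> U x -> U y -> U (x - y).
Proof. by move=> [_ Ul] Ux Uy; rewrite addrC -scaleN1r; exact: Ul. Qed.

Lemma subspaceZ (U : set V) c x : subspace U -> U x -> U (c *: x).
Proof. by move=> [U0 Ul] Ux; rewrite -[_ *: _]addr0; exact: Ul. Qed.

(** A maximal linear subset meeting [U] trivially is a complement.  Candidates may
    be empty, so that the union of an empty chain is one of them. *)
Lemma exists_complement (U : set V) : subspace U ->
  exists W : set V, [/\ subspace W, (forall x, W x -> U x -> x = 0)
    & forall v, exists u w, [/\ U u, W w & v = u + w]].
Proof.
move=> sU; have [U0 Ul] := sU.
pose P (A : set V) := (forall (c : k) x y, A x -> A y -> A (c *: x + y)) /\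
  forall x, A x -> U x -> x = 0.
have [F FP Ftot|W [[Wl WU] Wmax]] := @Zorn_bigcup V P.
  split; last by move=> x [A FA Ax]; exact: (FP _ FA).2.
  move=> c x y [A FA Ax] [B FB By].
  have [AB|BA] := Ftot _ _ FA FB.
    by exists B => //; apply: (FP _ FB).1 => //; exact: AB.
  by exists A => //; apply: (FP _ FA).1 => //; exact: BA.
have W0 : W 0.
  have [[a Wa]|We] := pselect (exists a, W a).
    by have := Wl (-1) a a Wa Wa; rewrite scaleN1r addNr.
  exfalso; apply: (Wmax [set 0]%classic).
    split; first by move=> x Wx; exfalso; apply: We; exists x.
    by move=> /(_ 0 erefl) W0; apply: We; exists 0.
  by split; [move=> c x y -> ->; rewrite scaler0 addr0 | move=> x ->].
exists W; split=> // v; apply: contrapT => nv.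
(* A vector [v] outside [U + W] would make [W + kv] a larger candidate. *)
apply: (Wmax [set x | exists c w, W w /\ x = c *: v + w]%classic).
  split; first by move=> w Ww; exists 0, w; rewrite scale0r add0r.
  move=> WW; apply: nv; exists 0, v; split=> //; last by rewrite add0r.
  by apply: WW; exists 1, 0; rewrite scale1r addr0.
split.
  move=> c x y [a [w [Ww ->]]] [b [w' [Ww' ->]]].
  exists (c * a + b), (c *: w + w'); split; first exact: Wl.
  by rewrite scalerDr scalerDl scalerA addrACA.
move=> x [c [w [Ww ->]]] Ux.
have [c0|c0] := eqVneq c 0.
  by move: Ux; rewrite c0 scale0r add0r; exact: WU.
exfalso; apply: nv; exists (c^-1 *: (c *: v + w)), (- c^-1 *: w); split.
- exact: subspaceZ.
- by rewrite -[_ *: _]addr0; exact: Wl.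
by rewrite scalerDr scalerA mulVf // scale1r scaleNr addrK.
Qed.

Lemma exists_functional (w : V) : w != 0 ->
  exists f : V -> k, (forall c x y, f (c *: x + y) = c * f x + f y) /\ f w = 1.
Proof.
move=> w0.
have sL : subspace [set c *: w | c in setT]%classic.
  split; first by exists 0; rewrite ?scale0r.
  move=> c x y [a _ <-] [b _ <-]; exists (c * a + b) => //.
  by rewrite scalerDl scalerA.
have [W [sW WL LW]] := exists_complement sL.
have ex v : exists c, W (v - c *: w).
  by have [_ [w' [[c _ <-] Ww ->]]] := LW v; exists c; rewrite addrAC subrr add0r.
pose f v := projT1 (cid (ex v)).
have fP v : W (v - f v *: w) by exact: projT2 (cid (ex v)).
have fE v c : W (v - c *: w) -> f v = c.
  move=> Wc; have /eqP : (c - f v) *: w = 0.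
    apply: WL; last by exists (c - f v).
    have := subspaceB sW (fP v) Wc.
    by rewrite opprB addrC subrKA -scalerBl.
  by rewrite scaler_eq0 (negbTE w0) orbF subr_eq0 => /eqP.
exists f; split; last by apply: fE; rewrite scale1r subrr; exact: sW.1.
move=> c x y; apply: fE.
have := sW.2 c _ _ (fP x) (fP y).
by rewrite scalerBr addrACA scalerA -opprD -scalerDl.
Qed.

End Complements.

(** * Cocycles, coboundaries and transport between equal degrees *)

Section ComplexBasics.
Context (k : fieldType) (C : complex k).

Definition tr (i j : int) (e : i = j) : C i -> C j :=
  match e in _ = j return C i -> C j with erefl => id end.

Lemma tr_id (i : int) (e : i = i) (x : C i) : tr e x = x.
Proof. by rewrite (eq_irrelevance e erefl). Qed.

Lemma tr_lin (i j : int) (e : i = j) c (x y : C i) :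
  tr e (c *: x + y) = c *: tr e x + tr e y.
Proof. by case: j / e. Qed.

Lemma cx_d_irr (i j : int) (e e' : i + 1 = j) (x : C i) : cx_d C e x = cx_d C e' x.
Proof. by rewrite (eq_irrelevance e e'). Qed.

Lemma d_tr (i j j' : int) (ej : j = j') (e : i + 1 = j) (e' : i + 1 = j') (x : C i) :
  tr ej (cx_d C e x) = cx_d C e' x.
Proof. by case: j' / ej e' => e'; exact: cx_d_irr. Qed.

Lemma cocycle_from (i j : int) (e : i + 1 = j) (x : C i) :
  cx_d C e x = 0 -> cocycle x.
Proof.
move=> dx j' e'; have jj : j' = j by lia.
by move: e'; rewrite jj => e'; rewrite (cx_d_irr e' e).
Qed.

Lemma coboundary_at (i j : int) (e : i + 1 = j) (x : C j) :
  coboundary x -> exists y : C i, x = cx_d C e y.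
Proof.
case=> i' [e' [y ->]]; have ii : i' = i by lia.
by move: e' y; rewrite ii => e' y; exists y; exact: cx_d_irr.
Qed.

Lemma coboundary_d (i j : int) (e : i + 1 = j) (y : C i) : coboundary (cx_d C e y).
Proof. by exists i, e, y. Qed.

Lemma coboundary0 (j : int) : coboundary (0 : C j).
Proof. by exists (j - 1), (subrK 1 j), 0; rewrite linear0. Qed.

Lemma coboundary_lin (j : int) c (x y : C j) :
  coboundary x -> coboundary y -> coboundary (c *: x + y).
Proof.
move=> /(coboundary_at (subrK 1 j)) [u ->] /(coboundary_at (subrK 1 j)) [v ->].
by rewrite -linearP; exact: coboundary_d.
Qed.

Lemma coboundary_sum (j : int) (I : finType) (P : pred I) (F : I -> C j) :
  (forall a, P a -> coboundary (F a)) -> coboundary (\sum_(a | P a) F a).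
Proof.
move=> FP; elim/big_ind: _ => //; first exact: coboundary0.
by move=> x y bx hy; rewrite -[x]scale1r; exact: coboundary_lin.
Qed.

Lemma coboundaryZ (j : int) c (x : C j) : coboundary x -> coboundary (c *: x).
Proof. by move=> bx; rewrite -[_ *: _]addr0; exact: coboundary_lin bx (coboundary0 j). Qed.

Lemma coboundaryD (j : int) (x y : C j) :
  coboundary x -> coboundary y -> coboundary (x + y).
Proof. by move=> bx hy; rewrite -[x]scale1r; exact: coboundary_lin. Qed.

Lemma coboundaryB (j : int) (x y : C j) :
  coboundary x -> coboundary y -> coboundary (x - y).
Proof. by move=> bx hy; rewrite addrC -scaleN1r; exact: coboundary_lin. Qed.

Lemma coboundary_cocycle (j : int) (x : C j) : coboundary x -> cocycle x.
Proof. by move=> [i [e [y ->]]] l e'; exact: cx_dd. Qed.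

Lemma cocycle_lin (j : int) c (x y : C j) :
  cocycle x -> cocycle y -> cocycle (c *: x + y).
Proof. by move=> dx dy l e; rewrite linearP /= dx dy scaler0 addr0. Qed.

Lemma cocycleB (j : int) (x y : C j) : cocycle x -> cocycle y -> cocycle (x - y).
Proof. by move=> dx dy l e; rewrite linearB /= dx dy subr0. Qed.

Lemma cocycleZ (j : int) c (x : C j) : cocycle x -> cocycle (c *: x).
Proof. by move=> dx l e; rewrite linearZ /= dx scaler0. Qed.

End ComplexBasics.

(** * The category of DG modules and graded maps *)

Section Composition.
Context (k : fieldType) (R : dgAlgebra k).

Lemma signK (z : int) : (-1 : k) ^ z * (-1) ^ z = 1.
Proof. by rewrite -exprzMl ?unitrN1 // mulrNN mulr1 exp1rz. Qed.

Lemma signD (y z : int) : (-1 : k) ^ (y + z) = (-1) ^ y * (-1) ^ z.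
Proof. by rewrite expfzDr // oppr_eq0 oner_eq0. Qed.

Lemma sign_succ (z : int) : (-1 : k) ^ (z + 1) = - (-1) ^ z.
Proof. by rewrite signD expr1z mulrN1. Qed.

Lemma sign_neq0 (z : int) : (-1 : k) ^ z != 0.
Proof. by apply/eqP => z0; have /eqP := signK z; rewrite z0 mul0r eq_sym oner_eq0. Qed.

Lemma signN (z : int) : (-1 : k) ^ (- z) = (-1) ^ z.
Proof. by apply: (mulfI (sign_neq0 z)); rewrite signK -signD subrr expr0z. Qed.

Lemma hom0 (X Y : dgModule R) n (f : hom X Y n) i j (e : i + n = j) : f i j e 0 = 0.
Proof. by rewrite -(scale0r 0) homZ scale0r. Qed.

Lemma homB (X Y : dgModule R) n (f : hom X Y n) i j (e : i + n = j) x y :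
  f i j e (x - y) = f i j e x - f i j e y.
Proof. by rewrite -!scaleN1r homD homZ. Qed.

Lemma homE_add (X Y : dgModule R) n (f g : hom X Y n) i j (e : i + n = j) x :
  (f + g) i j e x = f i j e x + g i j e x.
Proof. by []. Qed.

Lemma homE_scale (X Y : dgModule R) n c (f : hom X Y n) i j (e : i + n = j) x :
  (c *: f) i j e x = c *: f i j e x.
Proof. by []. Qed.

Lemma homE_sub (X Y : dgModule R) n (f g : hom X Y n) i j (e : i + n = j) x :
  (f - g) i j e x = f i j e x - g i j e x.
Proof. by rewrite -!scaleN1r. Qed.

Lemma hom_irr (X Y : dgModule R) n (f : hom X Y n) i j (e e' : i + n = j) x :
  f i j e x = f i j e' x.
Proof. by rewrite (eq_irrelevance e e'). Qed.

Lemma tr_act (N : dgModule R) a i i' j (ei : i = i') (e : a + i = j) (e' : a + i' = j)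
  (r : R a) (x : N i) : dgm_act e' r (tr ei x) = dgm_act e r x.
Proof. by case: i' / ei e' => e'; rewrite (eq_irrelevance e e'). Qed.

Lemma act_tr (N : dgModule R) a i j j' (ej : j = j') (e : a + i = j) (e' : a + i = j')
  (r : R a) (x : N i) : tr ej (dgm_act e r x) = dgm_act e' r x.
Proof. by case: j' / ej e' => e'; rewrite (eq_irrelevance e e'). Qed.

Lemma comp_deg (i n m p j : int) : n + m = p -> i + p = j -> i + n + m = j.
Proof. by move=> <- <-; rewrite addrA. Qed.

(** The intermediate degree is the canonical one; [hom_compE] allows any other. *)
Program Definition hom_comp (X Y Z : dgModule R) (n m p : int) (e : n + m = p)
    (g : hom Y Z m) (f : hom X Y n) : hom X Z p :=
  @Hom k R X Z p (fun i j ej x => g (i + n) j (comp_deg e ej) (f i (i + n) erefl x)) _ _.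
Next Obligation. by move=> X Y Z n m p e g f i j ej c x y /=; rewrite !hom_linear. Qed.
Next Obligation.
move=> X Y Z n m p e g f a i b j c eb ec ej ec' r x /=.
have e1 : a + (i + n) = b + n by lia.
rewrite (hom_act f eb erefl erefl e1) homZ.
rewrite (hom_act g e1 _ (comp_deg e ej) ec') scalerA -signD.
by congr ((-1) ^ _ *: _); rewrite -mulrDl e.
Qed.

Lemma hom_compE (X Y Z : dgModule R) (n m p : int) (e : n + m = p)
    (g : hom Y Z m) (f : hom X Y n) i j (ej : i + p = j) x
    i' (e1 : i + n = i') (e2 : i' + m = j) :
  hom_comp e g f i j ej x = g i' j e2 (f i i' e1 x).
Proof. by case: i' / e1 e2 => e2 /=; exact: hom_irr. Qed.

(** The Leibniz rule [D(gf) = D(g)f + (-1)^|g| g D(f)]; all later computations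
    with Hom complexes are formal consequences of it. *)
Lemma hom_diff_comp (X Y Z : dgModule R) (n m p n' m' p' : int) (e : n + m = p)
    (ep : p + 1 = p') (en : n + 1 = n') (em : m + 1 = m')
    (e1 : n + m' = p') (e2 : n' + m = p') (g : hom Y Z m) (f : hom X Y n) :
  hom_diff ep (hom_comp e g f) =
  hom_comp e1 (hom_diff em g) f + (-1) ^ m *: hom_comp e2 g (hom_diff en f).
Proof.
apply: homP => i j ej x; rewrite [LHS]/=.
have d1 : i + n + m = j - 1 by lia.
have d2 : (i + 1) + p = j by lia.
have d3 : i + p = j - 1 by lia.
have d4 : i + n + m' = j by lia.
have d5 : i + n + 1 + m = j by lia.
have d6 : i + 1 + n = i + n + 1 by lia.
have d7 : i + n' = i + n + 1 by lia.
rewrite (hom_diff_funE ep _ ej x (erefl (i + 1)) (subrK 1 j) d3 d2).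
rewrite (hom_compE _ _ _ _ _ (erefl (i + n)) d1) (hom_compE _ _ _ _ _ d6 d5).
rewrite homE_add homE_scale (hom_compE _ _ _ _ _ (erefl (i + n)) d4).
rewrite (hom_compE _ _ _ _ _ d7 d5) ![hom_fun (hom_diff _ _) _ _]/=.
rewrite (hom_diff_funE em g _ _ (erefl (i + n + 1)) (subrK 1 j) d1 d5).
rewrite (hom_diff_funE en f _ _ (erefl (i + 1)) (erefl (i + n + 1)) erefl d6).
rewrite homB homZ scalerBr scalerA addrA subrK -e signD.
by rewrite [(-1) ^ n * _]mulrC.
Qed.

Lemma hom_compA (X Y Z W : dgModule R) (a b c ab bc abc : int)
  (e1 : a + b = ab) (e2 : ab + c = abc) (e3 : b + c = bc) (e4 : a + bc = abc)
  (h : hom Z W c) (g : hom Y Z b) (f : hom X Y a) :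
  hom_comp e2 h (hom_comp e1 g f) = hom_comp e4 (hom_comp e3 h g) f.
Proof.
apply: homP => i j ej x.
have d1 : i + ab = i + a + b by lia.
have d2 : i + a + b + c = j by lia.
have d3 : i + a + bc = j by lia.
rewrite (hom_compE _ _ _ _ _ d1 d2) (hom_compE _ _ _ _ _ (erefl (i + a)) erefl).
by rewrite (hom_compE _ _ _ _ _ (erefl (i + a)) d3) (hom_compE _ _ _ _ _ erefl d2).
Qed.

Section OfFamily.
Context (X Y : dgModule R) (n : int) (phi : forall i, X i -> Y (i + n)).
Context (phi_lin : forall i c x y, phi (c *: x + y) = c *: phi x + @phi i y).
Context (phi_act : forall a i b (e : a + i = b) (e' : a + (i + n) = b + n)
  (r : R a) (x : X i), phi (dgm_act e r x) = (-1) ^ (n * a) *: dgm_act e' r (phi x)).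

(** A homogeneous map is determined by its values in the canonical target degree. *)
Program Definition hom_of : hom X Y n :=
  @Hom k R X Y n (fun i j e x => tr e (phi x)) _ _.
Next Obligation. by move=> i j e c x y /=; rewrite phi_lin tr_lin. Qed.
Next Obligation.
move=> a i b j c eb ec ej ec' r x; case: c / ec ec' => ec'; case: j / ej ec' => ec'.
by rewrite !tr_id; exact: phi_act.
Qed.

Lemma hom_ofE i (e : i + n = i + n) x : hom_of i (i + n) e x = phi x.
Proof. exact: tr_id. Qed.

End OfFamily.

Section OfFamily0.
Context (X Y : dgModule R) (phi : forall i, X i -> Y i).
Context (phi_lin : forall i c x y, phi (c *: x + y) = c *: phi x + @phi i y).
Context (phi_act : forall a i b (e : a + i = b) (r : R a) (x : X i),
  phi (dgm_act e r x) = dgm_act e r (phi x)).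

Program Definition hom0_of : hom X Y 0 :=
  @Hom k R X Y 0 (fun i j e x => phi (tr (etrans (esym (addr0 i)) e) x)) _ _.
Next Obligation. by move=> i j e c x y /=; rewrite tr_lin phi_lin. Qed.
Next Obligation.
move=> a i b j c eb ec ej ec' r x /=.
move: (etrans _ ec) (etrans _ ej) => ebc eij; move: ec'.
case: c / ebc {ec}; case: j / eij {ej} => ec' /=; rewrite mul0r expr0z scale1r phi_act.
by rewrite (eq_irrelevance ec' eb).
Qed.

Lemma hom0_ofE i (e : i + 0 = i) x : hom0_of i i e x = phi x.
Proof. by rewrite /= tr_id. Qed.

Lemma hom0_of_diff : (forall i j (e : i + 1 = j) x, phi (cx_d X e x) = cx_d Y e (phi x)) ->
  forall n (e : 0 + 1 = n), hom_diff e hom0_of = 0.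
Proof.
move=> phi_d n e; apply: homP => i j ej x; rewrite [LHS]/=.
have ei : i + 1 = j by lia.
rewrite (hom_diff_funE e _ ej x ei ei (addr0 i) (addr0 j)).
by rewrite !hom0_ofE phi_d expr0z scale1r subrr.
Qed.

End OfFamily0.

Definition hom_id (X : dgModule R) : hom X X 0 := @hom0_of X X (fun i x => x)
  (fun i c x y => erefl) (fun a i b e r x => erefl).

Lemma hom_idE (X : dgModule R) i (e : i + 0 = i) x : hom_id X i i e x = x.
Proof. exact: hom0_ofE. Qed.

Lemma hom_compf1 (X Y : dgModule R) n (e : 0 + n = n) (f : hom X Y n) :
  hom_comp e f (hom_id X) = f.
Proof.
by apply: homP => i j ej x; rewrite (hom_compE _ _ _ _ _ (addr0 i) ej) hom_idE.
Qed.

Lemma hom_comp1f (X Y : dgModule R) n (e : n + 0 = n) (f : hom X Y n) :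
  hom_comp e (hom_id Y) f = f.
Proof.
by apply: homP => i j ej x; rewrite (hom_compE _ _ _ _ _ ej (addr0 j)) hom_idE.
Qed.

Lemma hom_id_chain (X : dgModule R) : cocycle (C := hom_cx X X) (hom_id X).
Proof. by move=> n e; exact: hom0_of_diff. Qed.

End Composition.

Section CompositionLinear.
Context (k : fieldType) (R : dgAlgebra k) (X Y Z : dgModule R) (n m p : int).
Context (e : n + m = p).
Implicit Types (f : hom X Y n) (g : hom Y Z m).

Lemma hom_comp_linr g c f f' :
  hom_comp e g (c *: f + f') = c *: hom_comp e g f + hom_comp e g f'.
Proof. by apply: homP => i j ej x /=; rewrite hom_linear. Qed.

Lemma hom_comp_linl c g g' f :
  hom_comp e (c *: g + g') f = c *: hom_comp e g f + hom_comp e g' f.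
Proof. by apply: homP. Qed.

Lemma hom_comp0 g : hom_comp e g (0 : hom X Y n) = 0.
Proof. by apply: homP => i j ej x /=; rewrite hom0. Qed.

Lemma hom_0comp f : hom_comp e (0 : hom Y Z m) f = 0.
Proof. exact: homP. Qed.

Lemma hom_compZr g c f : hom_comp e g (c *: f) = c *: hom_comp e g f.
Proof. by rewrite -[c *: f]addr0 hom_comp_linr hom_comp0 addr0. Qed.

Lemma hom_compZl c g f : hom_comp e (c *: g) f = c *: hom_comp e g f.
Proof. by rewrite -[c *: g]addr0 hom_comp_linl hom_0comp addr0. Qed.

Lemma hom_compBr g f f' : hom_comp e g (f - f') = hom_comp e g f - hom_comp e g f'.
Proof. by rewrite addrC -scaleN1r hom_comp_linr scaleN1r addrC. Qed.

Lemma hom_compBl g g' f : hom_comp e (g - g') f = hom_comp e g f - hom_comp e g' f.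
Proof. by rewrite addrC -scaleN1r hom_comp_linl scaleN1r addrC. Qed.

End CompositionLinear.

Section CompositionChain.
Context (k : fieldType) (R : dgAlgebra k) (X Y Z : dgModule R) (n m p : int).
Context (e : n + m = p).
Implicit Types (f : hom X Y n) (g : hom Y Z m).

Lemma comp_chain g f : cocycle (C := hom_cx X Y) f -> cocycle (C := hom_cx Y Z) g ->
  cocycle (C := hom_cx X Z) (hom_comp e g f).
Proof.
move=> cf cg q eq; have e1 : n + (m + 1) = q by lia.
have e2 : n + 1 + m = q by lia.
rewrite [LHS](hom_diff_comp e eq erefl erefl e1 e2).
by rewrite (cf _ erefl : hom_diff _ _ = 0) (cg _ erefl : hom_diff _ _ = 0)
  hom_0comp hom_comp0 scaler0 addr0.
Qed.

Lemma comp_coboundaryl g f : cocycle (C := hom_cx X Y) f ->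
  coboundary (C := hom_cx Y Z) g -> coboundary (C := hom_cx X Z) (hom_comp e g f).
Proof.
move=> cf /(coboundary_at (subrK 1 m)) [u gE]; rewrite {}gE.
have e1 : n + (m - 1) = p - 1 by lia.
have e2 : n + 1 + (m - 1) = p by lia.
exists (p - 1), (subrK 1 p), (hom_comp e1 u f).
rewrite [RHS](hom_diff_comp e1 (subrK 1 p) erefl (subrK 1 m) e e2).
by rewrite (cf _ erefl : hom_diff _ _ = 0) hom_comp0 scaler0 addr0.
Qed.

Lemma comp_coboundaryr g f : coboundary (C := hom_cx X Y) f ->
  cocycle (C := hom_cx Y Z) g -> coboundary (C := hom_cx X Z) (hom_comp e g f).
Proof.
move=> /(coboundary_at (subrK 1 n)) [u fE] cg; rewrite {}fE.
have e1 : n - 1 + m = p - 1 by lia.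
have e2 : n - 1 + (m + 1) = p by lia.
exists (p - 1), (subrK 1 p), (hom_comp e1 ((-1) ^ m *: g) u).
rewrite [RHS](hom_diff_comp e1 (subrK 1 p) (subrK 1 n) erefl e2 e).
rewrite linearZ /= (cg _ erefl : hom_diff _ _ = 0) scaler0 hom_0comp add0r.
by rewrite hom_compZl scalerA signK scale1r.
Qed.

End CompositionChain.

Section Chain.
Context (k : fieldType) (R : dgAlgebra k).

(** Chain maps of degree [n] commute with the differentials up to [(-1)^n]. *)
Definition is_chain (X Y : dgModule R) n (p : hom X Y n) : Prop :=
  cocycle (C := hom_cx X Y) p.

Lemma chain_d (X Y : dgModule R) n (p : hom X Y n) : is_chain p ->
  forall i j i' j' (e : i + n = j) (ei : i + 1 = i') (ej : j + 1 = j')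
    (e' : i' + n = j') (x : X i),
  cx_d Y ej (p i j e x) = (-1) ^ n *: p i' j' e' (cx_d X ei x).
Proof.
move=> cp i j i' j' e ei ej e' x.
have ex : i + (n + 1) = j' by lia.
have := congr1 (fun h : hom X Y (n + 1) => h i j' ex x) (cp (n + 1) erefl).
rewrite [X in X = _]/= (hom_diff_funE _ _ _ _ ei ej e e') => /eqP.
by rewrite subr_eq0 => /eqP.
Qed.

Lemma chainP (X Y : dgModule R) n (p : hom X Y n) :
  (forall i (x : X i), exists j i' j' (e : i + n = j) (ei : i + 1 = i') (ej : j + 1 = j')
    (e' : i' + n = j'), cx_d Y ej (p i j e x) = (-1) ^ n *: p i' j' e' (cx_d X ei x)) ->
  is_chain p.
Proof.
move=> cp m em; apply: homP => i l el x; rewrite [LHS]/=.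
have [j [i' [j' [e [ei [ej [e' E]]]]]]] := cp i x.
have jl : j' = l by lia.
by case: l / jl el => el; rewrite (hom_diff_funE _ _ _ _ ei ej e e') E subrr.
Qed.

Lemma chain_cocycle (X Y : dgModule R) n (p : hom X Y n) i j (e : i + n = j) (x : X i) :
  is_chain p -> cocycle x -> cocycle (p i j e x).
Proof.
move=> cp cx j' ej; have e' : i + 1 + n = j' by lia.
by rewrite (chain_d cp e erefl ej e') cx hom0 scaler0.
Qed.

Lemma chain_coboundary (X Y : dgModule R) n (p : hom X Y n) i j (e : i + n = j) (x : X i) :
  is_chain p -> coboundary x -> coboundary (p i j e x).
Proof.
move=> cp /(coboundary_at (subrK 1 i)) [y ->].
have e1 : i - 1 + n = j - 1 by lia.
have := chain_d cp e1 (subrK 1 i) (subrK 1 j) e y.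
move=> /(congr1 (fun v => (-1) ^ n *: v)); rewrite scalerA signK scale1r => <-.
exact/coboundaryZ/coboundary_d.
Qed.

End Chain.

(** * The fibre of a chain map of arbitrary degree *)

Section Fiber.
Context (k : fieldType) (R : dgAlgebra k) (X Y : dgModule R) (n : int) (p : hom X Y n).
Context (p_chain : is_chain p).

(** The fibre is [X] plus the shift of [Y] by [n - 1].  The usual signs of that
    shift, [(-1)^(n-1)] for the differential and [(-1)^((n-1)a)] for the action of
    [R^a], are what makes [p : X -> Y] a legal off-diagonal term of the
    differential. *)
Definition fiber_obj (i : int) : lmodType k := (cx_obj X i * cx_obj Y (i + (n - 1))%R)%type.

Lemma fiber_deg1 i j : i + 1 = j -> i + n = j + (n - 1).
Proof. by lia. Qed.

Lemma fiber_deg2 i j : i + 1 = j -> i + (n - 1) + 1 = j + (n - 1).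
Proof. by lia. Qed.

Lemma fiber_deg3 a i j : a + i = j -> a + (i + (n - 1)) = j + (n - 1).
Proof. by lia. Qed.

Definition fiber_d i j (e : i + 1 = j) (u : fiber_obj i) : fiber_obj j :=
  (cx_d X e u.1,
   p i (j + (n - 1)) (fiber_deg1 e) u.1 + (-1) ^ (n - 1) *: cx_d Y (fiber_deg2 e) u.2).

Lemma fiber_d_linear i j (e : i + 1 = j) : linear (fiber_d e).
Proof.
move=> c u v; congr pair; first exact: linearP.
rewrite /= hom_linear linearP /= scalerDr addrACA.
by rewrite [in RHS]scalerDr !scalerA mulrC.
Qed.

HB.instance Definition _ i j (e : i + 1 = j) :=
  GRing.isLinear.Build k (fiber_obj i) (fiber_obj j) *:%R (fiber_d e) (fiber_d_linear e).

Lemma fiber_dd i j l (e : i + 1 = j) (e' : j + 1 = l) (u : fiber_obj i) :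
  fiber_d e' (fiber_d e u) = 0.
Proof.
congr pair; rewrite /= ?cx_dd // linearD linearZ /= cx_dd scaler0 addr0.
rewrite (chain_d p_chain _ e _ (fiber_deg1 e')).
have -> : (-1 : k) ^ n = - (-1) ^ (n - 1) by rewrite -sign_succ subrK.
by rewrite scaleNr scalerN scalerA signK scale1r subrr.
Qed.

Definition fiber_cx : complex k :=
  @Complex k fiber_obj (fun i j e => fiber_d e) fiber_dd.

Definition fiber_act a i j (e : a + i = j) (r : R a) (u : fiber_cx i) : fiber_cx j :=
  (dgm_act e r u.1, (-1) ^ ((n - 1) * a) *: dgm_act (fiber_deg3 e) r u.2).

Program Definition fiber : dgModule R := @DGModule k R fiber_cx fiber_act _ _ _ _ _.
Next Obligation.
move=> a i j e c r r' u; congr pair; rewrite /= dgm_act_linearl // scalerDr.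
by rewrite !scalerA mulrC.
Qed.
Next Obligation.
move=> a i j e c r u v; congr pair; rewrite /= dgm_act_linearr // scalerDr.
by rewrite !scalerA mulrC.
Qed.
Next Obligation.
move=> a b i ab bi abi e1 e2 e3 e4 r s u; congr pair; first exact: dgm_actA.
rewrite /= (dgm_actA _ _ (fiber_deg3 e3) (fiber_deg3 e4)) dgm_actZ scalerA -signD.
by congr ((-1) ^ _ *: _); rewrite -e1 mulrDr.
Qed.
Next Obligation.
move=> i e [x y]; congr pair; rewrite /= ?dgm_act1 //.
by rewrite mulr0 expr0z scale1r.
Qed.
Next Obligation.
move=> a i m a' i' m' e ea ei em e1 e2 r [x y]; congr pair; rewrite /=.
  exact: dgm_leibniz.
rewrite linearZ /=.
rewrite (dgm_leibniz _ ea (fiber_deg2 ei) (fiber_deg2 em) (fiber_deg3 e1) (fiber_deg3 e2)).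
rewrite (hom_act p e (fiber_deg1 em) (fiber_deg1 ei) (fiber_deg3 e2)).
rewrite dgm_actD dgm_actZ.
have -> : (-1 : k) ^ ((n - 1) * a') = (-1) ^ (n - 1) * (-1) ^ ((n - 1) * a).
  by rewrite -ea mulrDr mulr1 signD mulrC.
have -> : (-1 : k) ^ (n * a) = (-1) ^ a * (-1) ^ ((n - 1) * a).
  by rewrite -signD mulrBl mul1r addrC subrK.
rewrite !scalerDr !scalerA [LHS]addrCA.
by congr (_ + (_ + _ *: _)); rewrite [RHS]mulrC mulrA [LHS]mulrAC.
Qed.

Program Definition fiber_in : hom X fiber 0 :=
  @hom0_of k R X fiber (fun i x => (x, 0) : fiber_obj i) _ _.
Next Obligation. by move=> i c x y; congr pair; rewrite /= scaler0 addr0. Qed.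
Next Obligation. by move=> a i b e r x; congr pair; rewrite /= dgm_act0 scaler0. Qed.

Program Definition fiber_pr : hom fiber X 0 :=
  @hom0_of k R fiber X (fun i u => u.1) _ _.
Next Obligation. by []. Qed.
Next Obligation. by []. Qed.

Program Definition fiber_snd : hom fiber Y (n - 1) :=
  @hom_of k R fiber Y (n - 1) (fun i u => u.2) _ _.
Next Obligation. by []. Qed.
Next Obligation.
by move=> a i b e e' r u /=; rewrite (eq_irrelevance (fiber_deg3 e) e').
Qed.

Lemma fiber_deg4 i : i = i + (1 - n) + (n - 1).
Proof. by lia. Qed.

Program Definition fiber_inr : hom Y fiber (1 - n) :=
  @hom_of k R Y fiber (1 - n)
    (fun i y => (0, tr (fiber_deg4 i) y) : fiber_obj (i + (1 - n))) _ _.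
Next Obligation. by move=> i c x y; congr pair; rewrite /= ?scaler0 ?addr0 ?tr_lin. Qed.
Next Obligation.
move=> a i b e e' r y; congr pair; rewrite /= ?dgm_act0 ?scaler0 // scalerA.
have -> : (1 - n) * a = - ((n - 1) * a) by rewrite -mulNr opprB.
have e'' : a + i = b + (1 - n) + (n - 1) by lia.
by rewrite signN signK scale1r (tr_act _ e'') (act_tr _ _ e'').
Qed.

Lemma fiber_inE i (e : i + 0 = i) x : fiber_in i i e x = (x, 0).
Proof. exact: hom0_ofE. Qed.

Lemma fiber_prE i (e : i + 0 = i) u : fiber_pr i i e u = u.1.
Proof. exact: hom0_ofE. Qed.

Lemma fiber_sndE i (e : i + (n - 1) = i + (n - 1)) u : fiber_snd i _ e u = u.2.
Proof. exact: hom_ofE. Qed.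

Lemma fiber_inrE i j (e : j + (1 - n) = i) (e' : j = i + (n - 1)) y :
  fiber_inr j i e y = (0, tr e' y).
Proof.
case: i / e e' => e'; rewrite hom_ofE; congr (_, tr _ _); exact: eq_irrelevance.
Qed.

Lemma fiber_pr_chain : is_chain fiber_pr.
Proof. by move=> m e; exact: hom0_of_diff. Qed.

Lemma fiber_inr_chain : is_chain fiber_inr.
Proof.
apply: chainP => j y.
have [i ij] : {i : int | j = i + (n - 1)} by exists (j - (n - 1)); lia.
have e : j + (1 - n) = i by lia.
have e' : j + 1 + (1 - n) = i + 1 by lia.
have ij' : j + 1 = i + 1 + (n - 1) by lia.
subst j; exists i, (i + (n - 1) + 1), (i + 1), e, erefl, erefl, e'.
rewrite (fiber_inrE _ erefl) (fiber_inrE _ ij').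
congr pair; rewrite /= ?linear0 ?scaler0 // hom0 add0r.
have -> : 1 - n = - (n - 1) by rewrite opprB.
by rewrite signN (d_tr _ _ (fiber_deg2 erefl)).
Qed.

(** The failure of [fiber_in] and [fiber_snd] to be chain maps is measured by [p];
    these two formulas replace the connecting maps of the long exact sequences
    of the fibre. *)
Lemma fiber_in_diff (e : 0 + 1 = 1) (e' : n + (1 - n) = 1) :
  hom_diff e fiber_in = hom_comp e' fiber_inr p.
Proof.
apply: homP => i j ej x; rewrite [LHS]/=.
have ei : i + 1 = j by lia.
have e1 : i + n = j + (n - 1) by lia.
have e2 : j + (n - 1) + (1 - n) = j by lia.
rewrite (hom_diff_funE e _ ej x ei ei (addr0 i) (addr0 j)).
rewrite (hom_compE _ _ _ _ _ e1 e2) (fiber_inrE e2 erefl) !fiber_inE expr0z scale1r.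
congr pair; rewrite /= ?subrr // linear0 scaler0 addr0 subr0.
exact: hom_irr.
Qed.

Lemma fiber_snd_diff (e : n - 1 + 1 = n) (e' : 0 + n = n) :
  hom_diff e fiber_snd = (-1) ^ n *: hom_comp e' p fiber_pr.
Proof.
apply: homP => i j ej u; rewrite [LHS]/= homE_scale.
have ei : i + (n - 1) + 1 = j by lia.
have ej' : i + 1 + (n - 1) = j by lia.
rewrite (hom_compE _ _ _ _ _ (addr0 i) ej) fiber_prE.
move: ej ei; rewrite -{}ej' => ej ei.
rewrite (hom_diff_funE e _ ej u erefl ei erefl erefl) !fiber_sndE /=.
rewrite scalerDr scalerA signK scale1r opprD [LHS]addrCA.
rewrite (cx_d_irr ei (fiber_deg2 erefl)) subrr addr0.
have -> : (-1 : k) ^ n = - (-1) ^ (n - 1) by rewrite -sign_succ subrK.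
by rewrite scaleNr (hom_irr p ej (fiber_deg1 erefl)).
Qed.

Lemma fiber_pr_in (e : 0 + 0 = 0) : hom_comp e fiber_pr fiber_in = hom_id X.
Proof.
apply: homP => i j ej x; have ij : i = j by lia.
case: j / ij ej => ej; rewrite (hom_compE _ _ _ _ _ ej ej).
by rewrite fiber_inE fiber_prE hom_idE.
Qed.

Lemma fiber_snd_inr (e : 1 - n + (n - 1) = 0) : hom_comp e fiber_snd fiber_inr = hom_id Y.
Proof.
apply: homP => j l ej y; have jl : j = l by lia.
case: l / jl ej => ej.
have [i ij] : {i : int | j = i + (n - 1)} by exists (j - (n - 1)); lia.
subst j; have e1 : i + (n - 1) + (1 - n) = i by lia.
by rewrite (hom_compE _ _ _ _ _ e1 erefl) (fiber_inrE _ erefl) hom_idE fiber_sndE.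
Qed.

Lemma fiber_pr_inr m (e : 1 - n + 0 = m) : hom_comp e fiber_pr fiber_inr = 0.
Proof.
apply: homP => j i ej y.
have e1 : j + (1 - n) = i by lia.
have e2 : j = i + (n - 1) by lia.
by rewrite (hom_compE _ _ _ _ _ e1 (addr0 i)) (fiber_inrE _ e2) fiber_prE.
Qed.

Lemma fiber_id (e : 0 + 0 = 0) (e' : n - 1 + (1 - n) = 0) :
  hom_id fiber = hom_comp e fiber_in fiber_pr + hom_comp e' fiber_inr fiber_snd.
Proof.
apply: homP => i j ej u; have ij : i = j by lia.
case: j / ij ej => ej; rewrite hom_idE homE_add.
have e1 : i + (n - 1) + (1 - n) = i by lia.
rewrite (hom_compE _ _ _ _ _ ej ej) (hom_compE _ _ _ _ _ erefl e1).
rewrite fiber_prE fiber_inE fiber_sndE (fiber_inrE _ erefl) /=.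
by case: u => x y; congr pair; rewrite /= ?addr0 ?add0r.
Qed.

End Fiber.

(** * Exactness of Hom on fibres, and K-projective lifting *)

Section FiberHom.
Context (k : fieldType) (R : dgAlgebra k) (X Y : dgModule R) (n : int) (p : hom X Y n).
Context (p_chain : is_chain p).
Local Notation F := (fiber p_chain).
Local Notation inl_ := (fiber_in p_chain).
Local Notation pr_ := (fiber_pr p_chain).
Local Notation inr_ := (fiber_inr p_chain).
Local Notation snd_ := (fiber_snd p_chain).

(** Exactness at the middle of [Hom(Y, M) -> Hom(X, M) -> Hom(F, M)].  If [phi]
    restricted to [F] is [D(h)], then [h] is a cocycle on the copy of [Y] in [F],
    so it is [D(u)] there, and [phi] is [D(h fiber_in)] up to [D(u p)]. *)
Lemma coh_zero_hom_source (M : dgModule R) c :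
  coh_zero (hom_cx Y M) (c - n) -> coh_zero (hom_cx F M) c -> coh_zero (hom_cx X M) c.
Proof.
move=> HY HF phi cphi.
have e0 : 0 + c = c by exact: add0r.
have /(coboundary_at (subrK 1 c)) [h hE] : coboundary (C := hom_cx F M) (hom_comp e0 phi pr_).
  by apply/HF/comp_chain => //; exact: fiber_pr_chain.
have e1 : 1 - n + (c - 1) = c - n by lia.
have e2 : 1 - n + c = c - n + 1 by lia.
have e3 : 1 - n + 1 + (c - 1) = c - n + 1 by lia.
have Dhj : hom_diff erefl (hom_comp e1 h inr_) = 0.
  rewrite (hom_diff_comp e1 erefl erefl (subrK 1 c) e2 e3).
  rewrite (fiber_inr_chain p_chain erefl : hom_diff _ _ = 0) hom_comp0 scaler0 addr0.
  have e4 : 1 - n + 0 = 1 - n by exact: addr0.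
  by rewrite -[hom_diff _ h]hE -(hom_compA e4 e2 e0 e2) fiber_pr_inr hom_comp0.
have /HY bhj : cocycle (C := hom_cx Y M) (hom_comp e1 h inr_).
  exact: (@cocycle_from _ (hom_cx Y M) _ _ erefl _ Dhj).
have e5 : 0 + (c - 1) = c - 1 by exact: add0r.
have e6 : n + (c - n) = c by lia.
have e7 : 1 + (c - 1) = c by lia.
have e8 : n + (1 - n) = 1 by lia.
have DhI := hom_diff_comp e5 (subrK 1 c) (add0r 1) (subrK 1 c) e0 e7 h inl_.
rewrite (fiber_in_diff _ _ e8) (hom_compA e8 e7 e1 e6) -[hom_diff _ h]hE in DhI.
rewrite -(hom_compA (add0r 0) e0 e0 e0) fiber_pr_in hom_compf1 in DhI.
move/(congr1 (fun f => f - (-1) ^ (c - 1) *: hom_comp e6 (hom_comp e1 h inr_) p)): DhI.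
rewrite addrK => <-; apply: coboundaryB; first exact: (@coboundary_d _ (hom_cx X M)).
by apply: coboundaryZ; exact: comp_coboundaryl.
Qed.

(** Exactness at the middle of [Hom(F, M) -> Hom(Y, M) -> Hom(X, M)].  If
    [phi p = D(u)], then [u] and [phi] combine to a cocycle [w] on [F] that
    restricts to [phi], up to sign, on the copy of [Y]. *)
Lemma coh_zero_hom_target (M : dgModule R) l :
  coh_zero (hom_cx X M) (l + n) -> coh_zero (hom_cx F M) (l + n - 1) ->
  coh_zero (hom_cx Y M) l.
Proof.
move=> HX HF phi cphi.
have e1 : n + l = l + n by exact: addrC.
have /(coboundary_at (subrK 1 _)) [u uE] : coboundary (C := hom_cx X M) (hom_comp e1 phi p).
  by apply/HX/comp_chain.
have e2 : 0 + (l + n - 1) = l + n - 1 by exact: add0r.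
have e3 : n - 1 + l = l + n - 1 by lia.
pose w := hom_comp e2 u pr_ - (-1) ^ (l + n) *: hom_comp e3 phi snd_.
have cw : cocycle (C := hom_cx F M) w.
  apply: (@cocycle_from _ _ _ (l + n) (subrK 1 _)); rewrite [LHS]linearB linearZ /=.
  have f2 : 0 + (l + n) = l + n by exact: add0r.
  have f3 : 0 + 1 + (l + n - 1) = l + n by lia.
  have f4 : n - 1 + (l + 1) = l + n by lia.
  rewrite (hom_diff_comp e2 (subrK 1 _) erefl (subrK 1 _) f2 f3).
  rewrite (hom_diff_comp e3 (subrK 1 _) (subrK 1 n) erefl f4 e1).
  rewrite (fiber_pr_chain p_chain erefl : hom_diff _ _ = 0) hom_comp0 scaler0 addr0.
  rewrite (cphi _ erefl : hom_diff _ _ = 0) hom_0comp add0r.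
  rewrite (fiber_snd_diff _ _ (add0r n)) hom_compZr -[hom_diff _ u]uE.
  rewrite (hom_compA (add0r n) e1 e1 f2) !scalerA -mulrA -signD signK.
  by rewrite scale1r subrr.
have e4 : 1 - n + (l + n - 1) = l by lia.
have : coboundary (C := hom_cx Y M) (hom_comp e4 w inr_).
  by apply: comp_coboundaryl (HF _ cw); exact: fiber_inr_chain.
rewrite hom_compBl hom_compZl -(hom_compA (addr0 _) e4 e2 e4) fiber_pr_inr hom_comp0.
have e5 : 1 - n + (n - 1) = 0 by lia.
rewrite -(hom_compA e5 (add0r l) e3 e4) fiber_snd_inr hom_compf1 sub0r.
move=> /(coboundaryZ (- (-1) ^ (l + n))).
by rewrite scaleNr scalerN opprK scalerA signK scale1r.
Qed.

(** Exactness at the middle of [Hom(X, M) -> Hom(F, M) -> Hom(Y, M)].  A primitive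
    [h] of [phi] on the copy of [Y] extends to [F] by [fiber_snd]; subtracting the
    coboundary of this extension leaves a cocycle that factors through [X]. *)
Lemma coh_zero_hom_fiber (M : dgModule R) l :
  coh_zero (hom_cx Y M) (l + 1 - n) -> coh_zero (hom_cx X M) l ->
  coh_zero (hom_cx F M) l.
Proof.
move=> HY HX phi cphi.
have e1 : 1 - n + l = l + 1 - n by lia.
have f1 : l - n + 1 = l + 1 - n by lia.
have /(coboundary_at f1) [h hE] : coboundary (C := hom_cx Y M) (hom_comp e1 phi inr_).
  by apply/HY/comp_chain => //; exact: fiber_inr_chain.
have e2 : n + (l - n) = l by lia.
have e3 : 0 + l = l by exact: add0r.
pose psi := hom_comp e3 phi inl_ - (-1) ^ l *: hom_comp e2 h p.
have bpsi : coboundary (C := hom_cx X M) psi.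
  apply: HX; apply: (@cocycle_from _ _ _ (l + 1) erefl); rewrite [LHS]linearB linearZ /=.
  have f2 : 0 + (l + 1) = l + 1 by exact: add0r.
  have f3 : 1 + l = l + 1 by lia.
  have f4 : n + (l + 1 - n) = l + 1 by lia.
  have f5 : n + 1 + (l - n) = l + 1 by lia.
  have f6 : n + (1 - n) = 1 by lia.
  rewrite (hom_diff_comp e3 erefl (add0r 1) erefl f2 f3).
  rewrite (hom_diff_comp e2 erefl erefl f1 f4 f5).
  rewrite (p_chain erefl : hom_diff _ _ = 0) hom_comp0 scaler0 addr0.
  rewrite (cphi _ erefl : hom_diff _ _ = 0) hom_0comp add0r.
  rewrite (fiber_in_diff _ _ f6) -[hom_diff _ h]hE.
  by rewrite (hom_compA f6 f3 e1 f4) subrr.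
have e4 : n - 1 + (l - n) = l - 1 by lia.
have g1 : n - 1 + (l + 1 - n) = l by lia.
have DhQ := hom_diff_comp e4 (subrK 1 l) (subrK 1 n) f1 g1 e2 h snd_.
have g2 : n - 1 + (1 - n) = 0 by lia.
rewrite (fiber_snd_diff _ _ (add0r n)) hom_compZr scalerA -signD subrK in DhQ.
rewrite (hom_compA (add0r n) e2 e2 e3) -[hom_diff _ h]hE in DhQ.
rewrite -(hom_compA g2 e3 e1 g1) in DhQ.
have -> : phi = hom_comp e3 psi pr_ + hom_diff (subrK 1 l) (hom_comp e4 h snd_).
  rewrite DhQ hom_compBl hom_compZl addrCA subrK.
  rewrite -(hom_compA (add0r 0) e3 e3 e3) -[hom_comp e3 _ (hom_comp g2 _ _)]scale1r.
  by rewrite -hom_comp_linr scale1r addrC -fiber_id hom_compf1.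
apply: coboundaryD; last exact: (@coboundary_d _ (hom_cx F M)).
by apply: comp_coboundaryl => //; exact: fiber_pr_chain.
Qed.

Lemma K_projective_fiber : K_projective X -> K_projective Y -> K_projective F.
Proof.
move=> KX KY N aN l; apply: coh_zero_hom_fiber; [exact: KY | exact: KX].
Qed.

End FiberHom.

Section Lifting.
Context (k : fieldType) (R : dgAlgebra k).

(** If [h] is a primitive of the cocycle [phi], regarded as a map to the fibre, then
    its [X]-component is the lift and its [Y]-component the homotopy. *)
Lemma lift_acyclic_fiber (X Y T : dgModule R) (p : hom X Y 0) (p_chain : is_chain p) l
    (e : l + 0 = l) (phi : hom T Y l) :
  acyclic (fiber p_chain) -> K_projective T -> is_chain phi ->
  exists2 psi : hom T X l, is_chain psi &
    coboundary (C := hom_cx T Y) (hom_comp e p psi - phi).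
Proof.
move=> aF KT cphi.
have e1 : l + (1 - 0) = l + 1 by lia.
have : coboundary (C := hom_cx T (fiber p_chain)) (hom_comp e1 (fiber_inr p_chain) phi).
  apply: KT => //; apply: comp_chain => //; exact: fiber_inr_chain.
move=> /(coboundary_at erefl) [h hE].
exists (hom_comp e (fiber_pr p_chain) h).
  apply: (@cocycle_from _ _ _ (l + 1) erefl).
  have e2 : l + (0 + 1) = l + 1 by lia.
  rewrite [LHS](hom_diff_comp e erefl erefl erefl e2 (addr0 _)).
  rewrite (fiber_pr_chain p_chain erefl : hom_diff _ _ = 0) hom_0comp add0r.
  rewrite -[hom_diff _ h]hE (hom_compA e1 (addr0 _) (addr0 _) e1) fiber_pr_inr.
  by rewrite hom_0comp scaler0.
have e2 : l + (0 - 1) = l - 1 by lia.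
have e3 : l + 1 + (0 - 1) = l by lia.
exists (l - 1), (subrK 1 l), (hom_comp e2 (fiber_snd p_chain) h).
rewrite [RHS](hom_diff_comp e2 (subrK 1 l) erefl (subrK 1 0) e e3).
rewrite (fiber_snd_diff _ _ (add0r 0)) expr0z scale1r -[hom_diff _ h]hE.
rewrite (hom_compA e (e) (add0r 0) e); congr (_ + _).
have e4 : 1 - 0 + (0 - 1) = 0 :> int by lia.
rewrite (hom_compA e1 e3 e4 e) fiber_snd_inr hom_comp1f.
by rewrite sub0r signN expr1z scaleN1r.
Qed.

End Lifting.

(** * Cohomology of the fibre *)

Section Spanning.
Context (k : fieldType).

(** The classes are allowed to be dependent, so that the bound [N] passes to
    subspaces and quotients without choosing bases. *)
Definition coh_span (C : complex k) (i : int) (N : nat) : Prop :=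
  exists e : 'I_N -> C i, (forall a, cocycle (e a)) /\
    forall x, cocycle x ->
      exists c : 'I_N -> k, coboundary (x - \sum_a c a *: e a).

Lemma coh_span0 (C : complex k) i : coh_span C i 0 <-> coh_zero C i.
Proof.
split=> [[e [_ eP]] x /eP[c]|z]; first by rewrite big_ord0 subr0.
exists (fun _ => 0); split=> [[]|x /z bx] //.
by exists (fun _ => 0); rewrite big_ord0 subr0.
Qed.

Lemma lf_coh_span (C : complex k) i : locally_finite C -> exists N, coh_span C i N.
Proof.
move=> /(_ i); rewrite /coh_dim; case: xgetP => // _ -> [N [e [ce eP]] <-] _.
exists N, e; split=> // x /eP[c [bc _]]; exists (fun a => c 0 a); exact: bc.
Qed.

Context (R : dgAlgebra k) (X Y : dgModule R) (n : int) (p : hom X Y n).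
Context (p_chain : is_chain p).

(** When [p] is surjective in cohomology in the relevant degree, [H^i] of the fibre
    is the kernel of [H^i(X) -> H^(i+n)(Y)]; hence lifts to the fibre of classes
    spanning this kernel span [H^i] of the fibre. *)
Lemma fiber_span (i : int) (N : nat) (e : 'I_N -> X i) :
  (forall a, cocycle (e a)) ->
  (forall a j (ej : i + n = j), coboundary (p i j ej (e a))) ->
  (forall x, cocycle x -> (forall j (ej : i + n = j), coboundary (p i j ej x)) ->
    exists c : 'I_N -> k, coboundary (x - \sum_a c a *: e a)) ->
  (forall j l (ej : j + n = l), j + 1 = i -> forall y : Y l, cocycle y ->
    exists2 t : X j, cocycle t & coboundary (y - p j l ej t)) ->
  coh_span (fiber p_chain) i N.
Proof.
move=> ce be eP surj; set s : k := (-1) ^ (n - 1).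
pose j := i + 1 + (n - 1).
have d1 : i + n = j by rewrite /j; lia.
have d2 : i + (n - 1) + 1 = j by rewrite /j; lia.
have ex_w a : exists w : Y (i + (n - 1)), p i j d1 (e a) + s *: cx_d Y d2 w = 0.
  have [y yE] := coboundary_at d2 (be a j d1).
  exists (- s *: y); rewrite linearZ /= -yE scalerA mulrN signK scaleN1r subrr //.
have [w wE] := choice ex_w.
pose f a : fiber p_chain i := (e a, w a).
have fE (c : 'I_N -> k) : (\sum_a c a *: f a).1 = \sum_a c a *: e a.
  by rewrite (big_morph (fun u : fiber_obj X Y n i => u.1) (id1 := 0) (op1 := +%R)).
have fiberd u : cx_d (fiber p_chain) erefl u =
    (cx_d X erefl u.1, p i j d1 u.1 + s *: cx_d Y d2 u.2) :> fiber_obj X Y n (i + 1).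
  by congr (_, _ + _ *: _); [exact: hom_irr | exact: cx_d_irr].
exists f; split=> [a|u cu].
  apply: (@cocycle_from _ (fiber p_chain) _ _ erefl).
  by rewrite fiberd /= ce wE.
have cu1 : cocycle u.1.
  apply: (@cocycle_from _ X _ _ erefl).
  by have := congr1 fst (cu _ erefl); rewrite fiberd.
have pu : p i j d1 u.1 + s *: cx_d Y d2 u.2 = 0.
  by have := congr1 snd (cu _ erefl); rewrite fiberd.
have [|c /(coboundary_at (subrK 1 i)) [x xE]] := eP u.1 cu1.
  move=> l el; have jl : j = l by lia.
  case: l / jl el => el; rewrite (hom_irr p el d1).
  have -> : p i j d1 u.1 = cx_d Y d2 (- s *: u.2).
    by rewrite linearZ /= scaleNr; apply/eqP; rewrite -addr_eq0 pu.
  exact: coboundary_d.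
exists c.
(* What remains of [u] has no [X]-component, so it is a cocycle of [Y], which by
   surjectivity is a coboundary in the fibre. *)
pose v : fiber p_chain i := u - \sum_a c a *: f a - cx_d (fiber p_chain) (subrK 1 i)
  ((x, 0) : fiber_obj X Y n (i - 1)).
have v1 : v.1 = 0.
  rewrite -[v.1]/(u.1 - (\sum_a c a *: f a).1 - cx_d X (subrK 1 i) x).
  by rewrite fE xE subrr.
have cf a : cocycle (f a).
  by apply: (@cocycle_from _ (fiber p_chain) _ _ erefl); rewrite fiberd /= ce wE.
have cv : cocycle v.
  apply: cocycleB; last exact/coboundary_cocycle/coboundary_d.
  apply: cocycleB => // q eq; rewrite linear_sum big1 // => a _.
  by rewrite linearZ /= (cf a q eq) scaler0.
have cv2 : cocycle v.2.
  apply: (@cocycle_from _ Y _ _ d2).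
  have := congr1 snd (cv _ erefl); rewrite fiberd v1 /= hom0 add0r.
  move=> /(congr1 (fun y => s *: y)); rewrite scalerA signK scale1r scaler0.
  exact.
have d3 : i - 1 + n = i + (n - 1) by lia.
have [t ct] := surj (i - 1) _ d3 (subrK 1 i) v.2 cv2.
have d4 : i - 1 + (n - 1) + 1 = i + (n - 1) by lia.
move=> /(coboundary_at d4) [y yE].
have -> : u - \sum_a c a *: f a = v + cx_d (fiber p_chain) (subrK 1 i)
  ((x, 0) : fiber_obj X Y n (i - 1)) by rewrite subrK.
clearbody v.
apply: coboundaryD; last exact: coboundary_d.
exists (i - 1), (subrK 1 i), ((t, s *: y) : fiber_obj X Y n (i - 1)).
rewrite [LHS]surjective_pairing v1; congr pair; rewrite /=; first by rewrite ct.
rewrite linearZ /= scalerA signK scale1r (cx_d_irr _ d4) -yE (hom_irr p _ d3).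
by rewrite [RHS]addrC subrK.
Qed.

End Spanning.

Section QuasiIso.
Context (k : fieldType) (R : dgAlgebra k) (X Y : dgModule R) (p : hom X Y 0).

Lemma quasi_iso_chain : quasi_iso p -> is_chain p. Proof. by case. Qed.

Lemma quasi_iso_fiber_acyclic (qp : quasi_iso p) : acyclic (fiber (quasi_iso_chain qp)).
Proof.
have [_ inj surj] := qp; move=> i; apply/coh_span0.
apply: (@fiber_span _ _ _ _ _ _ _ i 0 (fun _ => 0)) => [[]//|[]//|x cx bx|j l ej _ y cy].
  by exists (fun _ => 0); rewrite big_ord0 subr0; exact/inj.
have jl : j = l by lia.
case: l / jl ej y cy => ej y cy; rewrite (eq_irrelevance ej (addr0 j)); exact: surj.
Qed.

Lemma quasi_iso_lift (T : dgModule R) l (e : l + 0 = l) (phi : hom T Y l) :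
  quasi_iso p -> K_projective T -> is_chain phi ->
  exists2 psi : hom T X l, is_chain psi &
    coboundary (C := hom_cx T Y) (hom_comp e p psi - phi).
Proof. by move=> qp; exact: (lift_acyclic_fiber e (quasi_iso_fiber_acyclic (qp := qp))). Qed.

End QuasiIso.

(** * DG submodules and truncations *)

Section SubModule.
Context (k : fieldType) (R : dgAlgebra k) (N : dgModule R).

Record sub_dg := SubDG {
  sub_set :> forall i, set (N i);
  sub_subspace : forall i, subspace (@sub_set i);
  sub_d : forall i j (e : i + 1 = j) (x : N i), sub_set x -> sub_set (cx_d N e x);
  sub_act : forall a i j (e : a + i = j) (r : R a) (x : N i),
    sub_set x -> sub_set (dgm_act e r x) }.

Context (S : sub_dg).

Definition sub_pred (i : int) : {pred N i} := fun x => `[< S i x >].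
Arguments sub_pred i : clear implicits.

Lemma sub_submod_closed i : submod_closed (sub_pred i).
Proof.
have [S0 Sl] := sub_subspace S i.
split; first exact/asboolP.
by move=> c x y /asboolP Sx /asboolP Sy; apply/asboolP; exact: Sl.
Qed.

HB.instance Definition _ i :=
  GRing.isSubmodClosed.Build k (N i) (sub_pred i) (sub_submod_closed i).

Definition sub_obj i := {x : N i | x \in sub_pred i}.

HB.instance Definition _ i := SubChoice.on (sub_obj i).
HB.instance Definition _ i := [SubChoice_isSubLmodule of sub_obj i by <:].

Lemma sub_valP i (x : sub_obj i) : S i (val x).
Proof. exact/asboolP/(valP x). Qed.

Definition sub_mk i (x : N i) (Sx : S i x) : sub_obj i := exist _ x (asboolT Sx).

Definition sub_d_fun i j (e : i + 1 = j) (x : sub_obj i) : sub_obj j :=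
  sub_mk (sub_d e (sub_valP x)).

Lemma sub_d_linear i j (e : i + 1 = j) : linear (sub_d_fun e).
Proof. by move=> c x y; apply: val_inj; rewrite /= !linearP. Qed.

HB.instance Definition _ i j (e : i + 1 = j) :=
  GRing.isLinear.Build k (sub_obj i) (sub_obj j) *:%R (sub_d_fun e) (sub_d_linear e).

Program Definition sub_cx : complex k :=
  @Complex k (fun i => sub_obj i : lmodType k) (fun i j e => sub_d_fun e) _.
Next Obligation. by move=> i j l e e' x; apply: val_inj; rewrite /= cx_dd. Qed.

Definition sub_act_fun a i j (e : a + i = j) (r : R a) (x : sub_cx i) : sub_cx j :=
  sub_mk (sub_act e r (sub_valP x)).

Program Definition sub_module : dgModule R := @DGModule k R sub_cx sub_act_fun _ _ _ _ _.
Next Obligation.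
by move=> *; apply: val_inj; rewrite /= dgm_act_linearl.
Qed.
Next Obligation.
by move=> *; apply: val_inj; rewrite /= dgm_act_linearr.
Qed.
Next Obligation. by move=> *; apply: val_inj; exact: dgm_actA. Qed.
Next Obligation. by move=> *; apply: val_inj; exact: dgm_act1. Qed.
Next Obligation.
move=> a i m a' i' m' e ea ei em e1 e2 r x; apply: val_inj.
by rewrite /= -(dgm_leibniz e ea ei em e1 e2).
Qed.

Program Definition sub_incl : hom sub_module N 0 :=
  @hom0_of k R sub_module N (fun i x => val x) _ _.
Next Obligation. by []. Qed.
Next Obligation. by []. Qed.

Lemma sub_inclE i (e : i + 0 = i) x : sub_incl i i e x = val x.
Proof. exact: hom0_ofE. Qed.

Lemma sub_incl_chain : is_chain sub_incl.
Proof. by move=> m e; exact: hom0_of_diff. Qed.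

Lemma sub_cocycle i (x : sub_module i) : cocycle x <-> cocycle (val x).
Proof.
split=> cx j e; first by have := congr1 val (cx j e).
by apply: val_inj; exact: cx.
Qed.

Lemma sub_coboundary i j (e : j + 1 = i) (x : sub_module i) (y : N j) :
  S j y -> val x = cx_d N e y -> coboundary x.
Proof. by move=> Sy xy; exists j, e, (sub_mk Sy); exact: val_inj. Qed.

Program Definition sub_factor (X : dgModule R) n (f : hom X N n)
    (fS : forall i j e x, S j (f i j e x)) : hom X sub_module n :=
  @Hom k R X sub_module n (fun i j e x => sub_mk (fS i j e x)) _ _.
Next Obligation. by move=> *; apply: val_inj; rewrite /= hom_linear. Qed.
Next Obligation.
move=> X n f fS a i b j c eb ec ej ec' r x; apply: val_inj.
by rewrite /= -(hom_act f eb ec ej ec').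
Qed.

Lemma sub_factorE (X : dgModule R) n (e : n + 0 = n) (f : hom X N n) fS :
  hom_comp e sub_incl (@sub_factor X n f fS) = f.
Proof.
by apply: homP => i j ej x; rewrite (hom_compE _ _ _ _ _ ej (addr0 j)) sub_inclE.
Qed.

Lemma sub_factor_chain (X : dgModule R) n (f : hom X N n) fS :
  is_chain f -> is_chain (@sub_factor X n f fS).
Proof.
move=> cf; apply: chainP => i x.
have e : i + 1 + n = i + n + 1 by lia.
exists (i + n), (i + 1), (i + n + 1), erefl, erefl, erefl, e.
by apply: val_inj; exact: chain_d.
Qed.

Lemma sub_acyclic_null (X : dgModule R) n (f : hom X N n) :
  (forall i j e x, S j (f i j e x)) -> acyclic sub_module -> K_projective X ->
  is_chain f -> coboundary (C := hom_cx X N) f.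
Proof.
move=> fS aS KX cf; rewrite -(sub_factorE (addr0 n) fS).
by apply: comp_coboundaryr sub_incl_chain; apply: KX => //; exact: sub_factor_chain.
Qed.

End SubModule.

Section Truncation.
Context (k : fieldType) (R : cochainDGA k).

Lemma dgm_act0l (N : dgModule R) a i j (e : a + i = j) (x : N i) :
  dgm_act e (0 : R a) x = 0.
Proof.
have := dgm_act_linearl e (-1) (0 : R a) 0 x.
by rewrite scaler0 addr0 scaleN1r addNr.
Qed.

Lemma dgm_act_deg0 (N : dgModule R) i (e : 0 + i = i) (r : R 0) (x : N i) :
  dgm_act e r x = aug r *: x.
Proof.
rewrite -{1}(aug_deg0 r) -[aug r *: _]addr0 dgm_act_linearl dgm_act0l addr0.
by rewrite dgm_act1.
Qed.

Section TruncationSet.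
Context (N : dgModule R) (a : int) (W : forall i, set (N i)).
Context (W_subspace : forall i, subspace (@W i)).

(** Everything above degree [a], a subspace [W] in degree [a], and zero below.
    For any [W] this is a DG submodule, since [R] lives in nonnegative degrees and
    [R^0 = k].  The subspace is given in all degrees to avoid transporting it. *)
Definition trunc_set i (x : N i) : Prop := [\/ a < i, i = a /\ W x | x = 0].

Program Definition trunc : sub_dg N := @SubDG k R N trunc_set _ _ _.
Next Obligation.
move=> i; split=> [|c x y]; first exact: Or33.
have [ai|ia] := ltP a i; first by move=> *; exact: Or31.
case=> [ai|[ea Wx]|->]; [lia| |].
  case=> [ai|[_ Wy]|->]; [lia| |].
    by apply: Or32; split=> //; exact: (W_subspace i).2.
  by rewrite addr0; apply: Or32; split=> //; exact: subspaceZ.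
case=> [ai|[ea Wy]|->]; [lia| |].
  by rewrite scaler0 add0r; exact: Or32.
by rewrite scaler0 addr0; exact: Or33.
Qed.
Next Obligation.
move=> i j e x [ai|[ia _]|->]; [apply: Or31; lia|apply: Or31; lia|].
by rewrite linear0; exact: Or33.
Qed.
Next Obligation.
move=> b i j e r x Sx.
have [b0|b0|b0] := ltrgtP b 0.
- by rewrite (cdga_neg r b0) dgm_act0l; exact: Or33.
- case: Sx => [ai|[ia _]|->]; [apply: Or31; lia|apply: Or31; lia|].
  by rewrite dgm_act0; exact: Or33.
subst b; have ij : i = j by lia.
case: j / ij e => e; rewrite dgm_act_deg0.
case: Sx => [ai|[ia Wx]|->]; [exact: Or31| |by rewrite scaler0; exact: Or33].
by apply: Or32; split=> //; exact: subspaceZ.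
Qed.

End TruncationSet.

Section DegreewiseComplements.
Context (N : dgModule R) (U : forall i, set (N i)).
Context (U_subspace : forall i, subspace (@U i)).

Lemma exists_complements : exists W : forall i, set (N i), forall i,
  [/\ subspace (@W i), (forall x, @W i x -> @U i x -> x = 0)
    & forall v, exists u w, [/\ @U i u, @W i w & v = u + w]].
Proof.
pose P i := cid (exists_complement (U_subspace i)).
exists (fun i => projT1 (P i)) => i; exact: projT2 (P i).
Qed.

End DegreewiseComplements.

Lemma coboundary_subspace (N : complex k) i : subspace [set x : N i | coboundary x]%classic.
Proof. by split; [exact: coboundary0 | move=> c x y; exact: coboundary_lin]. Qed.

Lemma cocycle_subspace (N : complex k) i : subspace [set x : N i | cocycle x]%classic.
Proof.
by split; [exact/coboundary_cocycle/coboundary0 | move=> c x y; exact: cocycle_lin].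
Qed.

(** Truncate with a complement of the cocycles in degree [a]: the differential maps
    it isomorphically onto the coboundaries in degree [a + 1], which are all the
    cocycles there. *)
Lemma coh_bounded_acyclic_sub (M : dgModule R) (a : int) :
  (forall l, a < l -> coh_zero M l) ->
  exists S : sub_dg M, acyclic (sub_module S) /\
    forall i (x : M i), a < i -> S i x.
Proof.
move=> HM.
have [W Wc] := exists_complements (fun i => cocycle_subspace M i).
have sW i : subspace (@W i) by have [] := Wc i.
exists (trunc a sW); split; last by move=> i x ai; exact: Or31.
move=> i x /sub_cocycle cx; have [ai|[ia Wx]|x0] := sub_valP x.
- have [y yE] := coboundary_at (subrK 1 i) (HM i ai _ cx).
  have [ai1|ai1] := ltP a (i - 1).
    have Sy : trunc a sW (i - 1) y by exact: Or31.
    exact: sub_coboundary Sy yE.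
  have [_ _ /(_ y) [u [w [cu Ww yuw]]]] := Wc (i - 1).
  have ia : i - 1 = a by lia.
  have Sw : trunc a sW (i - 1) w by apply: Or32.
  apply: (sub_coboundary Sw (e := subrK 1 i)).
  by rewrite yE yuw linearD /= cu add0r.
- have [_ WU _] := Wc i; have -> : x = 0 by apply: val_inj; exact: WU.
  exact: coboundary0.
rewrite (_ : x = 0); [exact: coboundary0 | exact: val_inj].
Qed.

(** Truncate with a complement of the coboundaries in degree [a]: its cocycles
    represent [H^a(N)], and its image under the differential consists of all the
    coboundaries in degree [a + 1]. *)
Lemma coh_bounded_below_sub (N : dgModule R) (a : int) :
  (forall l, l < a -> coh_zero N l) ->
  exists S : sub_dg N, quasi_iso (sub_incl S) /\
    forall i (x : N i), i < a -> S i x -> x = 0.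
Proof.
move=> HN.
have [W Wc] := exists_complements (fun i => coboundary_subspace N i).
have sW i : subspace (@W i) by have [] := Wc i.
exists (trunc a sW); split; last by move=> i x ia [ai|[ai _]|//]; exfalso; lia.
split; first exact: sub_incl_chain.
  move=> i x cx; rewrite sub_inclE => /[dup] bx /(coboundary_at (subrK 1 i)) [y yE].
  have [ai|[ia Wx]|x0] := sub_valP x; first last.
  - rewrite (_ : x = 0); [exact: coboundary0 | exact: val_inj].
  - have [_ WU _] := Wc i; have -> : x = 0 by apply: val_inj; exact: WU.
    exact: coboundary0.
  have [ai1|ai1] := ltP a (i - 1).
    have Sy : trunc a sW (i - 1) y by exact: Or31.
    exact: sub_coboundary Sy yE.
  have [_ _ /(_ y) [u [w [cu Ww yuw]]]] := Wc (i - 1).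
  have ia : i - 1 = a by lia.
  have Sw : trunc a sW (i - 1) w by apply: Or32.
  apply: (sub_coboundary Sw (e := subrK 1 i)).
  by rewrite yE yuw linearD /= (coboundary_cocycle cu) add0r.
move=> i y cy.
have [ai|ia|ia] := ltgtP a i.
- have Sy : trunc a sW i y by exact: Or31.
  exists (sub_mk Sy); first exact/sub_cocycle.
  by rewrite sub_inclE subrr; exact: coboundary0.
- exists 0; first exact/coboundary_cocycle/coboundary0.
  by rewrite hom0 subr0; exact: HN.
have [_ _ /(_ y) [u [w [bu Ww yuw]]]] := Wc i.
have Sw : trunc a sW i w by apply: Or32; split.
exists (sub_mk Sw); last by rewrite sub_inclE yuw addrK.
apply/sub_cocycle; rewrite [val _]/=; have -> : w = y - u by rewrite yuw addrAC subrr add0r.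
exact/cocycleB/coboundary_cocycle.
Qed.

(** Up to homotopy, [phi] factors through a submodule of [P] living in degrees
    [>= b]; so its values lie in degrees [>= c], hence in an acyclic submodule of
    [M]. *)
Lemma coh_zero_hom_above (P M : dgModule R) (b c : int) :
  K_projective P -> (forall l, l < b -> coh_zero P l) ->
  (forall l, c <= l -> coh_zero M l) -> coh_zero (hom_cx P M) (c - b).
Proof.
move=> KP HP HM phi cphi.
have [S [qS S0]] := coh_bounded_below_sub HP.
have [T [aT T1]] : exists S : sub_dg M, acyclic (sub_module S) /\
    forall i (x : M i), c - 1 < i -> S i x.
  by apply: coh_bounded_acyclic_sub => l lc; apply: HM; lia.
have [s cs bs] := quasi_iso_lift (addr0 0) qS KP (hom_id_chain P).
have e : 0 + (c - b) = c - b by exact: add0r.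
pose f := hom_comp e phi (hom_comp (addr0 0) (sub_incl S) s).
have -> : phi = f - hom_comp e phi (hom_comp (addr0 0) (sub_incl S) s - hom_id P).
  by rewrite hom_compBr hom_compf1 subKr.
apply: coboundaryB; last exact: comp_coboundaryr.
apply: (sub_acyclic_null _ aT) => //.
  move=> i j ej x; have [bi|ib] := leP b i; first by apply: T1; lia.
  rewrite /f (hom_compE _ _ _ _ _ (addr0 i) ej) (hom_compE _ _ _ _ _ (addr0 i) (addr0 i)).
  rewrite sub_inclE (S0 _ _ ib (sub_valP _)) hom0.
  exact: (sub_subspace T j).1.
apply: comp_chain cphi; apply: comp_chain => //; exact: sub_incl_chain.
Qed.

End Truncation.

(** * Detecting and removing a cohomology class *)

Section ResidueMaps.
Context (k : fieldType) (R : cochainDGA k).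

(** The value in [k] of an element of degree [0], and [0] in all other degrees *)
Definition coord (i : int) (v : residue R i) : k := \sum_s (v : 'rV[k]_(i == 0)) 0 s.

Lemma coord_lin i c (u v : residue R i) : coord (c *: u + v) = c * coord u + coord v.
Proof.
rewrite /coord; under eq_bigr do rewrite !mxE.
by rewrite big_split -mulr_sumr.
Qed.

Lemma coord_eq0 (v : residue R 0) : coord v = 0 -> v = 0.
Proof.
rewrite /coord big_ord1 => v0; apply/rowP => s; rewrite mxE -[RHS]v0.
by congr (v _ _); apply/val_inj; case: s => -[].
Qed.

Lemma coboundary_residue i (v : residue R i) : coboundary v -> v = 0.
Proof. by move=> [j [e [y ->]]]. Qed.

Lemma residue_act_pos a i j (e : a + i = j) (r : R a) (v : residue R i) :
  a != 0 -> dgm_act e r v = 0.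
Proof. by move=> a0; apply/rowP => s; rewrite !mxE aug_neq0 // mul0r. Qed.

Section ToResidue.
Context (N : dgModule R) (a : int) (f : N a -> k).
Context (f_lin : forall c x y, f (c *: x + y) = c * f x + f y).
Context (N_below : forall i (x : N i), i < a -> x = 0).

Definition extend_at (i : int) (x : N i) : k :=
  if i =P a is ReflectT e then f (tr e x) else 0.

Lemma extend_atE (x : N a) : extend_at x = f x.
Proof. by rewrite /extend_at; case: eqP => // e; rewrite tr_id. Qed.

Lemma extend_at_neq i (x : N i) : i != a -> extend_at x = 0.
Proof. by rewrite /extend_at; case: eqP. Qed.

Lemma extend_at_lin i c (x y : N i) :
  extend_at (c *: x + y) = c * extend_at x + extend_at y.
Proof.
by rewrite /extend_at; case: eqP => [e|_]; rewrite ?tr_lin ?f_lin // mulr0 addr0.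
Qed.

Lemma extend_at0 i : extend_at (0 : N i) = 0.
Proof. by have := extend_at_lin (-1) (0 : N i) 0; rewrite scaler0 addr0 mulN1r addNr. Qed.

(** When [N] vanishes below degree [a], any functional on [N^a] is [R]-linear: the
    elements of [R] of positive degree map no nonzero element of [N] to
    degree [a], and they act as zero on [k]. *)
Program Definition to_residue : hom N (residue R) (- a) :=
  @Hom k R N (residue R) (- a) (fun i j e x => const_mx (extend_at x)) _ _.
Next Obligation.
by move=> i j e c x y; apply/rowP => s; rewrite !mxE extend_at_lin.
Qed.
Next Obligation.
move=> b i b' j c eb ec ej ec' r x.
have [b0|b0|b0] := ltrgtP b 0.
- by rewrite (cdga_neg r b0) !dgm_act0l extend_at0 scaler0; apply/rowP => s; rewrite !mxE.
- have -> : extend_at (dgm_act eb r x) = 0.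
    have [ia|ai] := ltP i a; first by rewrite (N_below x ia) dgm_act0 extend_at0.
    by rewrite extend_at_neq //; lia.
  by rewrite residue_act_pos ?gt_eqF // scaler0; apply/rowP => s; rewrite !mxE.
subst b; have ij : i = b' by lia.
have jc : j = c by lia.
case: b' / ij eb ec => eb ec; case: c / jc ec ec' => ec ec'.
rewrite !dgm_act_deg0 mulr0 expr0z scale1r.
apply/rowP => s; rewrite !mxE.
by have := extend_at_lin (aug r) x 0; rewrite extend_at0 !addr0.
Qed.

Lemma to_residue_chain : is_chain to_residue.
Proof.
apply: chainP => i x.
exists (i - a), (i + 1), (i + 1 - a), erefl, erefl, (addrAC _ _ _), erefl.
have [ia|ai] := ltP i a; first by rewrite (N_below x ia) linear0 !hom0 linear0 scaler0.
have e : i + 1 != a by lia.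
by apply/rowP => s; rewrite !mxE extend_at_neq // mulr0.
Qed.

Lemma coord_to_residue (e : a + - a = 0) (x : N a) : coord (to_residue a 0 e x) = f x.
Proof. by rewrite /coord residue_sum_const // extend_atE. Qed.

End ToResidue.

Lemma coboundary_hom_apply (X Y : dgModule R) n (f : hom X Y n) i j (e : i + n = j) (x : X i) :
  coboundary (C := hom_cx X Y) f -> cocycle x -> coboundary (f i j e x).
Proof.
move=> /(coboundary_at (subrK 1 n)) [h ->] cx.
have e1 : i + (n - 1) = j - 1 by lia.
have e2 : i + 1 + (n - 1) = j by lia.
rewrite /= (hom_diff_funE _ _ _ _ erefl (subrK 1 j) e1 e2) cx hom0 scaler0 subr0.
exact: coboundary_d.
Qed.

Context (P : Kproj_resolution (residue R)).

Lemma resolution_coh_zero i : i != 0 -> coh_zero P i.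
Proof.
move=> i0 x cx; have [_ inj _] := kpr_quasi_iso P; apply: inj => //.
by rewrite (residue_eq0 (kpr_map P i i (addr0 i) x) i0); exact: coboundary0.
Qed.

(** Both cocycles have images in the line [H^0(k) = k], and the resolution detects
    coboundaries. *)
Lemma resolution_coh0 (z y : P 0) : cocycle z -> ~ coboundary z -> cocycle y ->
  exists c : k, coboundary (y - c *: z).
Proof.
move=> cz nz cy; have [_ inj _] := kpr_quasi_iso P.
pose v x := coord (kpr_map P 0 0 (addr0 0) x).
have vz : v z != 0.
  by apply/eqP => /coord_eq0 z0; apply: nz; apply: inj => //; rewrite z0; exact: coboundary0.
exists (v y / v z); apply: inj; first exact/cocycleB/cocycleZ.
rewrite (_ : kpr_map P _ _ _ _ = 0); first exact: coboundary0.
apply: coord_eq0; rewrite addrC -scaleNr hom_linear coord_lin.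
by rewrite mulNr -[coord _]/(v z) divfK // addNr.
Qed.

(** Move [T] into a truncation that vanishes below [a].  There [z] becomes a nonzero
    element, some functional takes the value [1] on it, and this functional is
    a map of DG modules to [k], which lifts to [P]. *)
Lemma exists_detecting_hom (T : dgModule R) (a : int) (z : T a) :
  K_projective T -> (forall l, l < a -> coh_zero T l) -> cocycle z -> ~ coboundary z ->
  exists2 p : hom T P (- a), is_chain p & forall e, ~ coboundary (p a 0 e z).
Proof.
move=> KT HT cz nz.
have [S [qS S0]] := coh_bounded_below_sub HT.
have [s cs bs] := quasi_iso_lift (addr0 0) qS KT (hom_id_chain T).
set w := s a a (addr0 a) z.
have w0 : w != 0.
  apply/eqP => w0; apply: nz.
  have := coboundary_hom_apply (addr0 a) bs cz.
  rewrite homE_sub hom_idE (hom_compE _ _ _ _ _ (addr0 a) (addr0 a)) -/w w0 hom0 sub0r.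
  by move=> /(coboundaryZ (-1)); rewrite scaleN1r opprK.
have [f [f_lin fw]] := exists_functional w0.
have S0' i (x : sub_module S i) : i < a -> x = 0.
  by move=> ia; apply: val_inj; apply: S0 ia (sub_valP x).
pose phi := to_residue f_lin S0'.
have cphi : is_chain phi by exact: to_residue_chain.
have e1 : 0 + - a = - a by exact: add0r.
have e2 : - a + 0 = - a by exact: addr0.
have [p cp bp] := quasi_iso_lift e2 (kpr_quasi_iso P) KT (comp_chain e1 cs cphi).
exists p => // e bz.
have := coboundary_hom_apply e bp cz; move/coboundary_residue.
rewrite homE_sub (hom_compE _ _ _ _ _ e (addr0 0)) (hom_compE _ _ _ _ _ (addr0 a) e).
have [ck _ _] := kpr_quasi_iso P.
rewrite (coboundary_residue (chain_coboundary (addr0 0) ck bz)) sub0r -/w.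
move=> /(congr1 (fun v => coord (-1 *: v + 0))); rewrite !coord_lin.
rewrite -scaleN1r -[-1 *: _]addr0 coord_lin coord_to_residue fw.
have -> : coord (0 : residue R 0) = 0 by rewrite /coord big_ord1 mxE.
by rewrite !addr0 mulr0 mulr1 mulrNN mulr1 => /eqP; rewrite oner_eq0.
Qed.

(** The fibre of a map to [P] detecting the class of [e ord0].  This map is
    surjective in cohomology, because [H(P) = k] is concentrated in degree [0];
    so the fibre has the cohomology of [T], except in degree [a], where the kernel
    is spanned by one class less. *)
Lemma exists_class_killing_hom (T : dgModule R) (a : int) (N : nat) (e : 'I_N.+1 -> T a) :
  K_projective T -> (forall l, l < a -> coh_zero T l) ->
  (forall b, cocycle (e b)) ->
  (forall x, cocycle x -> exists c : 'I_N.+1 -> k, coboundary (x - \sum_b c b *: e b)) ->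
  ~ coboundary (e ord0) ->
  exists (p : hom T P (- a)) (cp : is_chain p),
    coh_span (fiber cp) a N /\
    forall i m, i != a -> coh_span T i m -> coh_span (fiber cp) i m.
Proof.
move=> KT HT ce eP ne0.
have [p cp np] := exists_detecting_hom KT HT (ce ord0) ne0.
have ea : a + - a = 0 by exact: subrr.
have ex_t b : exists t, coboundary (p a 0 ea (e b) - t *: p a 0 ea (e ord0)).
  by apply: resolution_coh0 => //; exact: chain_cocycle.
have [t tP] := choice ex_t.
exists p, cp; split.
  apply: (@fiber_span _ _ _ _ _ _ cp a N
    (* correct the other classes by [e ord0] to land in the kernel *)
    (fun b => e (lift ord0 b) - t (lift ord0 b) *: e ord0)).
  - by move=> b; exact/cocycleB/cocycleZ.
  - move=> b j ej; have j0 : 0 = j by lia.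
    case: j / j0 ej => ej; rewrite homB homZ (eq_irrelevance ej ea); exact: tP.
  - move=> x cx /(_ 0 ea) bpx; have [c bc] := eP x cx.
    exists (fun b => c (lift ord0 b)).
    set y := \sum_b _; pose g := c ord0 + \sum_b c (lift ord0 b) * t (lift ord0 b).
    have xE : x - \sum_b c b *: e b = x - y - g *: e ord0.
      rewrite big_ord_recl -addrA -opprD; congr (_ - _).
      rewrite /y /g; under [in RHS]eq_bigr do rewrite scalerBr scalerA.
      by rewrite sumrB scalerDl scaler_suml [RHS]addrCA subrK.
    have bpy : coboundary (p a 0 ea y).
      rewrite /y (big_morph _ (fun u v => homD p ea u v) (hom0 p ea)).
      apply: coboundary_sum => b _; rewrite homZ homB homZ; exact/coboundaryZ/tP.
    have /eqP g0 : g == 0.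
      apply/eqP; apply: contrapT => /eqP g0; apply: (np ea).
      have := chain_coboundary ea cp bc; rewrite xE !homB homZ => bd.
      have := coboundaryB (coboundaryB bpx bpy) bd.
      by rewrite subKr => /(coboundaryZ g^-1); rewrite scalerA mulVf // scale1r.
    by move: bc; rewrite xE g0 scale0r subr0.
  - move=> j l ej ja y cy; exists 0; first exact/coboundary_cocycle/coboundary0.
    by rewrite hom0 subr0; apply: resolution_coh_zero cy; lia.
move=> i m ia [e' [ce' eP']].
apply: (@fiber_span _ _ _ _ _ _ cp i m e') => //.
- move=> b j ej; apply: resolution_coh_zero; first by lia.
  exact: chain_cocycle.
- by move=> x cx _; exact: eP'.
move=> j l ej ji y cy; have [l0|l0] := eq0_or l; last first.
  exists 0; first exact/coboundary_cocycle/coboundary0.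
  by rewrite hom0 subr0; exact: resolution_coh_zero.
have ja : a = j by lia.
case: j / ja ej ji => ej ji; subst l.
have [] := @resolution_coh0 (p a 0 ea (e ord0)) y => // [|c bc].
  exact: chain_cocycle.
exists (c *: e ord0); first exact: cocycleZ.
by rewrite homZ (hom_irr p ej ea).
Qed.

End ResidueMaps.

(** * Propagation of vanishing Bass numbers *)

Section GapTheorem.
Context (k : fieldType) (R : cochainDGA k).

Lemma K_projective_acyclic_coh_zero (T M : dgModule R) c :
  K_projective T -> acyclic T -> coh_zero (hom_cx T M) c.
Proof.
move=> KT aT phi cphi; rewrite -(hom_compf1 (add0r c) phi).
apply: comp_coboundaryr => //; apply: KT => //.
exact: hom_id_chain.
Qed.

(** Induction on the length of the interval of degrees supporting [H(T)], then on the
    number of classes spanning its lowest group [H^a(T)].  Passing from [T] to the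
    fibre of a map [T -> P] of degree [-a] removes one class at the cost of
    [H^(c+a)(Hom(P, M))]. *)
Lemma coh_zero_hom_of_bounded (P : Kproj_resolution (residue R)) (M : dgModule R)
    (c : int) (m : nat) :
  forall (a : int) (T : dgModule R), K_projective T ->
  (forall l, l < a -> coh_zero T l) -> (forall l, a + m%:Z <= l -> coh_zero T l) ->
  (forall l, exists N, coh_span T l N) ->
  (forall l, c + a <= l < c + a + m%:Z -> coh_zero (hom_cx P M) l) ->
  coh_zero (hom_cx T M) c.
Proof.
elim: m => [|m IHm] a T KT Tlo Thi Tspan HP.
  apply: K_projective_acyclic_coh_zero => // l.
  by have [la|al] := ltP l a; [exact: Tlo | apply: Thi; lia].
have [N TN] := Tspan a.
elim: N T KT Tlo Thi Tspan TN => [|N IHN] T KT Tlo Thi Tspan TN.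
  apply: (IHm (a + 1)) => //.
  - move=> l la; have [la'|al] := ltP l a; first exact: Tlo.
    by have -> : l = a; [lia | exact/coh_span0].
  - by move=> l al; apply: Thi; lia.
  by move=> l al; apply: HP; lia.
have [e [ce eP]] := TN.
have [b0|n0] := pselect (coboundary (e ord0)).
  apply: IHN => //; exists (fun b => e (lift ord0 b)); split=> // x /eP[d bd].
  exists (fun b => d (lift ord0 b)).
  rewrite -[_ - _](addrNK (d ord0 *: e ord0)); apply: coboundaryD; last exact: coboundaryZ.
  by move: bd; rewrite big_ord_recl opprD addrA addrAC.
have [p [cp [Fa Fspan]]] := exists_class_killing_hom P KT Tlo ce eP n0.
have Fzero l : l != a -> coh_zero T l -> coh_zero (fiber cp) l.
  by move=> la /coh_span0 Tl; apply/coh_span0/Fspan.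
apply: (@coh_zero_hom_source _ _ _ _ _ _ cp).
  by apply: HP; lia.
apply: IHN => //.
- by apply: K_projective_fiber => //; exact: kpr_K_projective.
- by move=> l la; apply: Fzero; [lia | exact: Tlo].
- by move=> l la; apply: Fzero; [lia | exact: Thi].
move=> l; have [->|la] := eqVneq l a; first by exists N.
by have [n Tn] := Tspan l; exists n; exact: Fspan.
Qed.

Definition regular : dgModule R := @DGModule k R (dga_cx R) (@dga_mul k R)
  (@dga_mul_linearl k R) (@dga_mul_linearr k R) (@dga_mulA k R) (@dga_mul1l k R)
  (@dga_leibniz k R).

Lemma hom_regular_eq (M : dgModule R) n (f h : hom regular M n) :
  (forall e, f 0 n e (dga_one R) = h 0 n e (dga_one R)) -> f = h.
Proof.
move=> fh; apply: homP => i j e r.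
have e' : i + n = j by [].
have e0 : i + 0 = i by exact: addr0.
rewrite -(dga_mul1r e0 r).
rewrite (hom_act f (e0 : i + 0 = i) e (add0r n) e' r (dga_one R : regular 0)).
by rewrite (hom_act h (e0 : i + 0 = i) e (add0r n) e' r (dga_one R : regular 0)) fh.
Qed.

Lemma d_one j (e : 0 + 1 = j) : cx_d R e (dga_one R) = 0.
Proof. by case: j / e; exact: cdga_deg1. Qed.

Section Translation.
Context (M : dgModule R) (n : int) (x : M n).

Program Definition right_translation : hom regular M n :=
  @hom_of k R regular M n (fun i r => (-1) ^ (n * i) *: dgm_act (erefl (i + n)) r x) _ _.
Next Obligation.
by move=> i c r s; rewrite /= dgm_act_linearl scalerDr !scalerA mulrC.
Qed.
Next Obligation.
move=> a i b e e' r s; rewrite /= (dgm_actA _ _ erefl e') dgm_actZ scalerA -signD.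
by congr ((-1) ^ _ *: _); rewrite -mulrDr e.
Qed.

Lemma right_translation_one (e : 0 + n = n) : right_translation 0 n e (dga_one R) = x.
Proof.
have E (m : int) (em : 0 + n = m) : right_translation 0 m em (dga_one R) =
    dgm_act em (dga_one R) x.
  by case: m / em; rewrite hom_ofE mulr0 expr0z scale1r.
by rewrite E dgm_act1.
Qed.

End Translation.

(** Evaluation at [1] identifies [Hom(R, M)] with [M]. *)
Lemma coh_zero_hom_regular (M : dgModule R) n :
  coh_zero M n -> coh_zero (hom_cx regular M) n.
Proof.
move=> HM phi cphi; set y := phi 0 n (add0r n) (dga_one R).
have cy : cocycle y.
  apply: chain_cocycle => // j e; exact: d_one.
have [x yx] := coboundary_at (subrK 1 n) (HM y cy).
exists (n - 1), (subrK 1 n), (right_translation x).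
apply: hom_regular_eq => e; rewrite (hom_irr phi e (add0r n)) -/y yx /=.
have e1 : 0 + 1 + (n - 1) = n by lia.
rewrite (hom_diff_funE _ _ _ _ erefl (subrK 1 n) (add0r _) e1).
by rewrite right_translation_one d_one hom0 scaler0 subr0.
Qed.

Lemma K_projective_regular : K_projective regular.
Proof. by move=> N aN n; exact: coh_zero_hom_regular. Qed.

Lemma one_not_coboundary : ~ coboundary (dga_one R).
Proof.
move=> /(coboundary_at (subrK 1 0)) [y].
rewrite (cdga_neg y) // linear0 => /(congr1 (@aug _ _ _)).
by rewrite aug1 aug0 => /eqP; rewrite oner_eq0.
Qed.

(** Apply the preceding lemmas to the fibre of the map [R -> P] that detects the
    class of [1]. *)
Lemma gap_propagates (P : Kproj_resolution (residue R)) (M : dgModule R) (j g : int) :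
  (forall l, g < l -> coh_zero R l) -> coh_zero M j ->
  (forall l, j + 1 <= l <= j + g -> coh_zero (hom_cx P M) l) ->
  coh_zero (hom_cx P M) j.
Proof.
move=> HR HM HP.
have R_neg l : l < 0 -> coh_zero regular l.
  by move=> l0 x _; rewrite (cdga_neg x l0); exact: coboundary0.
have R_one : coh_zero regular 1.
  by move=> x _; rewrite (cdga_deg1 x); exact: coboundary0.
have g0 : 0 <= g.
  have [//|g0] := leP 0 g; exfalso; apply: one_not_coboundary; apply: HR => // l e.
  exact: d_one.
have [|||p [cp [F0 Fspan]]] := @exists_class_killing_hom _ _ P regular 0 0
  (fun _ => dga_one R) K_projective_regular R_neg.
- by move=> _ l e; exact: d_one.
- move=> x _; exists (fun _ => aug x); rewrite big_ord1 aug_deg0 subrr.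
  exact: coboundary0.
- exact: one_not_coboundary.
have Fzero l : l != 0 -> coh_zero regular l -> coh_zero (fiber cp) l.
  by move=> l0 /coh_span0 Rl; apply/coh_span0/Fspan.
apply: (@coh_zero_hom_target _ _ _ _ _ _ cp).
  by apply: coh_zero_hom_regular; rewrite oppr0 addr0.
case: g HR HP g0 Fspan => // g HR HP _ Fspan.
(* The cohomology of the fibre lives in the [g - 1] degrees [2, ..., g]; the
   truncated predecessor also covers [g = 0], where the fibre is acyclic. *)
apply: (@coh_zero_hom_of_bounded P M _ g.-1 2).
- apply: K_projective_fiber; [exact: K_projective_regular | exact: kpr_K_projective].
- move=> l l2; have [->|l0] := eqVneq l 0; first exact/coh_span0.
  apply: Fzero => //; have [->//|l1] := eqVneq l 1.
  by apply: R_neg; lia.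
- by move=> l gl; apply: Fzero; [lia | apply: HR; lia].
- move=> l; have [->|l0] := eqVneq l 0; first by exists 0%N.
  by have [N RN] := lf_coh_span l (@cdga_lf k R); exists N; exact: Fspan.
by move=> l jl; apply: HP; lia.
Qed.

End GapTheorem.

(** * Dimensions, suprema and infima *)

Section Dimensions.
Context (k : fieldType) (C : complex k).

Lemma coh_dim_eq0 j : coh_dim C j = Some 0%N <-> coh_zero C j.
Proof.
rewrite /coh_dim; split.
  case: xgetP => // _ -> [n [e [_ eP]] <-] [n0]; subst n.
  by move=> x /eP[c [bc _]]; move: bc; rewrite big_ord0 subr0.
move=> z; case: xgetP => [_ -> [n [e [ce eP]] <-]|/(_ (Some 0%N)) []].
  case: n e ce eP => // n e ce eP; exfalso.
  have all_c (c : 'rV[k]_n.+1) : coboundary (0 - \sum_a c 0 a *: e a).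
    apply: z; apply: cocycleB; first exact/coboundary_cocycle/coboundary0.
    by move=> l el; rewrite linear_sum big1 // => a _; rewrite linearZ /= ce scaler0.
  have [c [_ c_unique]] := eP 0 (coboundary_cocycle (coboundary0 C j)).
  have /rowP/(_ ord0) := etrans (esym (c_unique 0 (all_c 0))) (c_unique (const_mx 1) (all_c _)).
  by rewrite !mxE => /eqP; rewrite eq_sym oner_eq0.
exists 0%N => //; exists (fun _ => 0); split=> [[]//|x cx].
exists 0; split; first by rewrite big_ord0 subr0; exact: z.
by move=> c _; apply/rowP => -[].
Qed.

(** An unbounded set has supremum [+oo]; a bounded one has a greatest element. *)
Lemma int_supremums_neq0 (A : set int) (l : int) :
  A l -> (supremums [set j%:E | j in A] !=set0)%classic.
Proof.
move=> Al; have [[b Ab]|unb] := pselect (exists b, forall j, A j -> j <= b); last first.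
  exists +oo%E; split=> [_ [j _ <-]|[r| |] rub]; rewrite ?leey //; last first.
    by have := rub _ (ex_intro2 _ _ l Al erefl).
  exfalso; apply: unb; exists r => j Aj.
  by have := rub _ (ex_intro2 _ _ j Aj erefl); rewrite lee_fin.
have exn : exists n : nat, `[< A (b - n%:Z) >].
  exists `|b - l|%N; apply/asboolP; have -> : b - `|b - l|%N%:Z = l by have := Ab l Al; lia.
  exact: Al.
case: (ex_minnP exn) => n /asboolP An min_n.
exists (b - n%:Z)%:E; split=> [_ [j Aj <-]|r rub]; last by apply: rub; exists (b - n%:Z).
rewrite lee_fin; have jb := Ab j Aj.
have : (n <= `|b - j|)%N.
  apply: min_n; apply/asboolP; have -> : b - `|b - j|%N%:Z = j by lia.
  exact: Aj.
by lia.
Qed.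

Lemma int_infimums_neq0 (A : set int) (l : int) :
  A l -> (infimums [set j%:E | j in A] !=set0)%classic.
Proof.
move=> Al; have [[b Ab]|unb] := pselect (exists b, forall j, A j -> b <= j); last first.
  exists -oo%E; split=> [_ [j _ <-]|[r| |] rlb]; rewrite ?leNye //; last first.
    by have := rlb _ (ex_intro2 _ _ l Al erefl).
  exfalso; apply: unb; exists r => j Aj.
  by have := rlb _ (ex_intro2 _ _ j Aj erefl); rewrite lee_fin.
have exn : exists n : nat, `[< A (b + n%:Z) >].
  exists `|b - l|%N; apply/asboolP; have -> : b + `|b - l|%N%:Z = l by have := Ab l Al; lia.
  exact: Al.
case: (ex_minnP exn) => n /asboolP An min_n.
exists (b + n%:Z)%:E; split=> [_ [j Aj <-]|r rlb]; last by apply: rlb; exists (b + n%:Z).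
rewrite lee_fin; have jb := Ab j Aj.
have : (n <= `|b - j|)%N.
  apply: min_n; apply/asboolP; have -> : b + `|b - j|%N%:Z = j by lia.
  exact: Aj.
by lia.
Qed.

Lemma coh_sup_ge l : ~ coh_zero C l -> (l%:E <= coh_sup C)%E.
Proof. by move=> nz; apply: ge_supremum_Nmem; [exact: int_supremums_neq0 nz | exists l]. Qed.

Lemma coh_inf_le l : ~ coh_zero C l -> (coh_inf C <= l%:E)%E.
Proof. by move=> nz; apply: le_infimum_Nmem; [exact: int_infimums_neq0 nz | exists l]. Qed.

End Dimensions.

(** * Amplitude and gaps *)

Theorem corollary4p11 (k : fieldType) (R : cochainDGA k)
    (P : Kproj_resolution (residue R)) (M : dgModule R) (g : int)
    (supR_fin : (coh_sup R < +oo)%E)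
    (M_lf : locally_finite M) (M_Dminus : in_Dminus M)
    (g_ge : (coh_sup R <= g%:E)%E)
    (gap : exists j : int,
       [/\ bass P M j <> Some 0%N,
           (forall l : int, j + 1 <= l <= j + g -> bass P M l = Some 0%N)
         & bass P M (j + g + 1) <> Some 0%N]) :
  ((g + 1)%:E <= amp M)%E.
Proof.
have [j [mu_j mu_gap mu_top]] := gap.
have Mj : ~ coh_zero M j.
  move=> Mj; apply/mu_j/coh_dim_eq0; apply: (gap_propagates (g := g)) Mj _ => [l gl|l jl].
    apply: contrapT => /coh_sup_ge lR.
    by have := le_trans lR g_ge; rewrite lee_fin leNgt gl.
  by apply/coh_dim_eq0; exact: mu_gap.
have [l jl Ml] : exists2 l, j + g + 1 <= l & ~ coh_zero M l.
  apply: contrapT => none; apply/mu_top/coh_dim_eq0; rewrite -[j + g + 1]subr0.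
  apply: coh_zero_hom_above => [|l l0|l jl]; first exact: kpr_K_projective.
    by apply: resolution_coh_zero; rewrite lt_eqF.
  by apply: contrapT => Ml; apply: none; exists l.
apply: (@le_trans _ _ (l%:E - j%:E)%E); first by rewrite -EFinB lee_fin; lia.
by apply: leeB; [exact: coh_sup_ge | exact: coh_inf_le].
Qed.
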